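(* Let $G$ be a locally compact abelian group with Haar measure $m$, let $\{K_\delta\}_{\delta\in\Delta}$ be a summing net for $G$, let $\psi\in L^\infty(G)$ and let $\alpha\in\mathbb{C}$. Then $\psi$ is almost convergent to $\alpha$ if and only if $$\lim_{\delta}\frac{1}{m(K_\delta)}\int_{K_\delta}\psi(x+s)\,dm(x)=\alpha$$ uniformly in $s\in G$.
   Context: $L^\infty(G)$ is the space of complex-valued essentially bounded measurable functions on $G$ with the norm $\|\cdot\|_\infty$. $P(G)$ is the set of nonnegative $f\in L^1(G)$ with $\int_G f\,dm=1$, and $(f*\psi)(x)=\int_G f(t)\psi(x-t)\,dm(t)$. A mean on $L^\infty(G)$ is a functional $\varphi\in L^\infty(G)^*$ with $\varphi(\psi)\ge 0$ for all $\psi\ge 0$ and $\varphi(\mathbf{1})=1$. It is topologically invariant if $\varphi(f*\psi)=\varphi(\psi)$ for all $\psi\in L^\infty(G)$ and $f\in P(G)$; $\mathcal{T}(G)$ is the set of topologically invariant means on $L^\infty(G)$. A function $\psi\in L^\infty(G)$ is almost convergent to $\alpha\in\mathbb{C}$ if $\varphi(\psi)=\alpha$ for every $\varphi\in\mathcal{T}(G)$. A summing net for $G$ is a net $\{K_\delta\}_{\delta\in\Delta}$ of compact subsets of $G$ with $m(K_\delta)>0$ such that: (1) $K_\delta\subseteq K_{\delta'}$ if $\delta\le\delta'$; (2) $G=\bigcup_\delta K_\delta$; (3) $\lim_\delta \frac{m(K_\delta\triangle (K_\delta+s))}{m(K_\delta)}=0$ uniformly for $s$ in each compact subset of $G$.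 *)

(* Defs.v *)
From HB Require Import structures.
From mathcomp Require Import all_boot all_order all_algebra.
From mathcomp Require Import all_classical all_reals all_analysis.
From mathcomp Require Import complex.

Set Implicit Arguments.
Unset Strict Implicit.
Unset Printing Implicit Defensive.

Import Order.TTheory GRing.Theory Num.Theory.
Import numFieldNormedType.Exports.

Local Open Scope classical_set_scope.
Local Open Scope complex_scope.
Local Open Scope ring_scope.

(* The library's [g_sigma_algebraType] asks for a pointed type, which a
   [topologicalZmodType] is not canonically; hence this alias, pointed at 0. *)
Definition borel (G : topologicalZmodType) : Type := G.

Section BorelInstances.
Variable G : topologicalZmodType.

HB.instance Definition _ := TopologicalZmodule.on (borel G).
HB.instance Definition _ := isPointed.Build (borel G) (0 : G).
HB.instance Definition _ := @isMeasurable.Build (sigma_display (@open G))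
  (borel G) <<s (@open G) >>
  (@sigma_algebra0 _ setT _) (@sigma_algebraC (borel G) _)
  (@sigma_algebra_bigcup _ setT _).

End BorelInstances.

Definition lca_group (G : topologicalZmodType) : Prop :=
  hausdorff_space G /\ locally_compact [set: G].

Definition translate (G : zmodType) (s : G) (A : set G) : set G :=
  [set x + s | x in A].

(* A nonzero translation-invariant Radon measure; [m] is countably additive on
   the Borel sets by its type. *)
Record haar_measure (R : realType) (G : topologicalZmodType)
    (m : {measure set (borel G) -> \bar R}) : Prop := {
  haar_neq0 : m setT != 0%E ;
  haar_compact : forall K : set G, compact K -> (m K < +oo)%E ;
  haar_outer : forall A : set (borel G), measurable A ->
    m A = ereal_inf [set m U | U in [set U : set G | open U /\ A `<=` U]] ;
  haar_inner : forall U : set G, open U ->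
    m U = ereal_sup [set m K | K in [set K : set G | compact K /\ K `<=` U]] ;
  haar_translate : forall (s : G) (A : set (borel G)), measurable A ->
    m (translate s A) = m A }.

Section Functions.
Variables (R : realType) (G : topologicalZmodType).
Variable m : {measure set (borel G) -> \bar R}.
Local Notation C := R[i].

Definition cmod (z : C) : R := Normc.normc z.

Definition cintegral (D : set G) (f : G -> C) : C :=
  (\int[m]_(x in D) complex.Re (f x)) +i* (\int[m]_(x in D) complex.Im (f x)).

Definition cmeasurable (f : G -> C) : Prop :=
  measurable_fun (setT : set (borel G)) (fun x => complex.Re (f x)) /\
  measurable_fun (setT : set (borel G)) (fun x => complex.Im (f x)).

Definition Linfty_norm (psi : G -> C) : \bar R :=
  ('N[m]_+oo [EFin \o (cmod \o psi)])%E.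

(* Elements of L^oo(G) are handled through representatives. *)
Definition Linfty : set (G -> C) :=
  [set psi : G -> C | cmeasurable psi /\ (Linfty_norm psi < +oo)%E].

(* Elements of P(G), again through representatives. *)
Definition L1_prob : set (G -> R) :=
  [set f : G -> R | [/\ m.-integrable (setT : set (borel G)) (EFin \o f),
               {ae m, forall x, 0 <= f x} &
               \int[m]_(x in setT) f x = 1]].

Definition convolution (f : G -> R) (psi : G -> C) : G -> C :=
  fun x => cintegral setT (fun t => (f t)%:C * psi (x - t)).

(* A functional in L^oo(G)^* is encoded as a map on all functions G -> C, only
   its values on [Linfty] being meaningful.  Linearity and the norm bound make
   it depend only on almost-everywhere classes. *)
Record dual_Linfty (phi : (G -> C) -> C) : Prop := {
  dual_linear : forall (a : C) (psi1 psi2 : G -> C),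
    Linfty psi1 -> Linfty psi2 ->
    phi (fun x => a * psi1 x + psi2 x) = a * phi psi1 + phi psi2 ;
  dual_bounded : exists M : R, forall psi : G -> C, Linfty psi ->
    ((cmod (phi psi))%:E <= M%:E * Linfty_norm psi)%E }.

(* In the order of [R[i]], [0 <= z] means that z is real and nonnegative. *)
Record is_mean (phi : (G -> C) -> C) : Prop := {
  mean_dual : dual_Linfty phi ;
  mean_ge0 : forall psi : G -> C, Linfty psi ->
    {ae m, forall x, 0 <= psi x} -> 0 <= phi psi ;
  mean_one : phi (fun=> 1) = 1 }.

Definition topologically_invariant (phi : (G -> C) -> C) : Prop :=
  forall (psi : G -> C) (f : G -> R), Linfty psi -> L1_prob f ->
    phi (convolution f psi) = phi psi.

Definition TIM : set ((G -> C) -> C) :=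
  [set phi : (G -> C) -> C | is_mean phi /\ topologically_invariant phi].

Definition almost_convergent (psi : G -> C) (alpha : C) : Prop :=
  forall phi, TIM phi -> phi psi = alpha.

End Functions.

Definition directed (disp : Order.disp_t) (D : preorderType disp) : Prop :=
  (exists d : D, True) /\
  forall d1 d2 : D, exists d3 : D, (d1 <= d3)%O /\ (d2 <= d3)%O.

(* [F d s] tends to [l] along the net, uniformly for [s] in [A].  For
   [V = R[i]] the norm is [R[i]]-valued and [0 < e] forces [e] to be real. *)
Definition net_cvg_unif (disp : Order.disp_t) (D : preorderType disp)
    (S : Type) (V : numDomainType) (A : set S) (F : D -> S -> V) (l : V) : Prop :=
  forall e : V, 0 < e -> exists d0 : D, forall d : D, (d0 <= d)%O ->
    forall s, A s -> `|F d s - l| < e.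

Record summing_net (R : realType) (G : topologicalZmodType)
    (m : {measure set (borel G) -> \bar R})
    (disp : Order.disp_t) (D : preorderType disp) (K : D -> set G) : Prop := {
  net_directed : directed D ;
  net_compact : forall d, compact (K d) ;
  net_gt0 : forall d, (0 < m (K d))%E ;
  net_incr : forall d1 d2 : D, (d1 <= d2)%O -> K d1 `<=` K d2 ;
  net_cover : \bigcup_d K d = [set: G] ;
  net_foelner : forall B : set G, compact B ->
    net_cvg_unif B
      (fun d s => fine (m (K d `+` translate s (K d))) / fine (m (K d))) 0 }.

Definition net_average (R : realType) (G : topologicalZmodType)
    (m : {measure set (borel G) -> \bar R}) (K : set G) (psi : G -> R[i])
    (s : G) : R[i] :=
  (fine (m K))^-1%:C * cintegral m K (fun x => psi (x + s)).

(* Main.v *)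
Require Import Defs.
From mathcomp Require Import finmap all_boot all_order all_algebra.
From mathcomp Require Import all_classical all_reals all_analysis.
From mathcomp Require Import complex.
From mathcomp Require Import measurable_realfun ess_sup_inf lra.

Set Implicit Arguments.
Unset Strict Implicit.
Unset Printing Implicit Defensive.

Import Order.TTheory GRing.Theory Num.Theory.
Import numFieldNormedType.Exports.

Local Open Scope classical_set_scope.
Local Open Scope ring_scope.

(** Write [A_d psi s] for the average of [psi] over the translate [K_d + s].

    From uniform convergence to almost convergence.  Since Haar measure is
    invariant under inversion, [A_d psi] is the convolution of [psi] with the
    probability density [1_(-K_d) / m(K_d)] ([rconv_kernel]).  A topologically
    invariant mean [phi] thus satisfies [phi psi = phi (A_d psi)], and since
    [A_d psi] is within [e] of the constant [alpha] in sup norm, [phi psi] is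
    within a multiple of [e] of [alpha] ([uniform_almost_convergent]).

    From almost convergence to uniform convergence.  If uniformity fails, there
    are [e], a cofinal set of bad indices [d] and points [s_d] at which
    [A_d psi (s_d)] stays at distance at least [e] from [alpha].  The limit of
    [A_d (.) (s_d)] along an ultrafilter that contains the tails of the net and
    the set of bad indices is a mean, and its value at [psi] is not [alpha].  It
    is topologically invariant because
      [A_d (f * psi) s - A_d psi s
         = \int f(t) (A_d psi (s - t) - A_d psi s) dm(t)]:
    the Foelner condition makes the integrand small, uniformly for [t] in a
    compact set which carries most of the mass of [f] ([avg_rconv_le],
    [ultra_avg_rconv]).

    Both halves exchange two integrals of functions of [x + t] or [x - t].  When
    [G] is not second countable, such a function need not be measurable for the
    product of the Borel sigma-algebras, so the exchange does not follow from
    the theorem of Tonelli on product measures.  It is derived from regularity.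
    For an open set [E] and sets [A], [C] of finite measure, the measure of
    [C `&` [set t | x + t \in E]] depends continuously on [x], and compactness
    cuts the region [x + t \in E], up to a small error, into finitely many
    rectangles ([shear_le_compact], [shear_eq_open]).  A pi-lambda argument
    passes to Borel sets ([shear_eq]), and monotone limits of simple functions
    pass to functions ([swappable_mul]).  The same exchange, used once with
    [x - t] and once with [x + t], yields [m (- E) = m E]
    ([measure_neg_compact]), the usual proof of which goes through the
    uniqueness of Haar measure. *)

(** * Borel sets and continuous maps *)

Section Borel.
Variable G : topologicalZmodType.

Lemma open_borel (U : set G) : open U -> measurable (U : set (borel G)).
Proof. exact: sub_sigma_algebra. Qed.

Lemma closed_borel (F : set G) : closed F -> measurable (F : set (borel G)).
Proof.
move=> cF; rewrite -(setCK F).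
apply: (@measurableC _ (borel G) (~` F)).
by apply: open_borel; rewrite openC.
Qed.

Lemma compact_borel (K : set G) :
  hausdorff_space G -> compact K -> measurable (K : set (borel G)).
Proof. by move=> hG cK; apply: closed_borel; exact: compact_closed. Qed.

Lemma continuous_borel (f : G -> G) : continuous f ->
  measurable_fun (setT : set (borel G)) (f : borel G -> borel G).
Proof.
move=> /continuousP cf.
apply: (@measurability _ _ (borel G) (borel G) setT f (@open G) erefl).
move=> _ [U oU <-]; rewrite setTI; apply: open_borel; exact: cf.
Qed.

Lemma continuous_measurable_real (R : realType) (f : G -> R) : continuous f ->
  measurable_fun (setT : set (borel G)) (f : borel G -> R).
Proof.
move=> /continuousP cf.
apply: (measurability _ (RGenOpens.measurableE R)).
move=> _ [_ [a [b ->] <-]]; rewrite setTI; apply: open_borel; apply: cf.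
exact: interval_open.
Qed.

Lemma continuous_addl (x : G) : continuous (fun t : G => x + t).
Proof.
move=> t; apply: (@continuous_comp _ _ _ (fun t : G => (x, t))
  (fun p : G * G => p.1 + p.2)); last exact: add_continuous.
by apply: cvg_pair => /=; [exact: cvg_cst|exact: cvg_id].
Qed.

Lemma continuous_addr (x : G) : continuous (fun t : G => t + x).
Proof.
rewrite (_ : (fun t : G => t + x) = (fun t : G => x + t)); first exact: continuous_addl.
by apply/funext => t; rewrite addrC.
Qed.

Lemma translate_preimage (s : G) (A : set G) :
  translate s A = (fun x : G => x - s) @^-1` A.
Proof.
apply/seteqP; split => [_ [x Ax <-]|x Ax] /=; first by rewrite addrK.
by exists (x - s) => //; rewrite subrK.
Qed.

Lemma measurable_translate (s : G) (A : set (borel G)) :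
  measurable A -> measurable (translate s A : set (borel G)).
Proof.
move=> mA; rewrite translate_preimage -[X in measurable X]setTI.
exact: (continuous_borel (@continuous_addr (- s))).
Qed.

End Borel.

(** * Regularity of Haar measure and continuity of translation *)

Section Regularity.
Variables (R : realType) (G : topologicalZmodType).
Hypothesis hG : hausdorff_space G.
Variable m : {measure set (borel G) -> \bar R}.
Hypothesis hm : haar_measure m.

Lemma outer_approx (A : set (borel G)) (e : R) :
  measurable A -> (m A < +oo)%E -> 0 < e ->
  exists U : set G, [/\ open U, A `<=` U & (m (U `\` A) < e%:E)%E].
Proof.
move=> mA Afin e0.
have Anum : m A \is a fin_num by rewrite ge0_fin_numE.
have [_ [U [oU AU] <-] mU] :
  exists2 y, [set m U | U in [set U : set G | open U /\ A `<=` U]] y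
   & (y < m A + e%:E)%E.
  by rewrite (haar_outer hm mA); apply: lb_ereal_inf_adherent;
    rewrite -?(haar_outer hm mA).
exists U; split => //.
have mUm := open_borel oU.
have Ufin : (m U < +oo)%E by rewrite (lt_trans mU)// lte_add_pinfty// ltry.
rewrite measureD// setIidr//= lteBlDl//.
Qed.

Lemma inner_approx_open (U : set G) (e : R) :
  open U -> (m U < +oo)%E -> 0 < e ->
  exists L : set G, [/\ compact L, L `<=` U & (m (U `\` L) < e%:E)%E].
Proof.
move=> oU Ufin e0.
have Unum : m U \is a fin_num by rewrite ge0_fin_numE.
have [_ [L [cL LU] <-] mL] :
  exists2 y, [set m L | L in [set L : set G | compact L /\ L `<=` U]] y
   & (m U - e%:E < y)%E.
  by rewrite (haar_inner hm oU); apply: ub_ereal_sup_adherent;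
    rewrite -?(haar_inner hm oU).
exists L; split => //.
have mLm := compact_borel hG cL.
have mUm := open_borel oU.
rewrite measureD// setIidr//= lteBlDl ?lteBlDr// ?ge0_fin_numE//.
  by rewrite -lteBlDr.
exact: haar_compact.
Qed.

(** Inner regularity is only assumed for open sets.  For a Borel set [A], take an
    open [U] around [A], a compact [L] that fills [U], and remove from [L] an
    open set of small excess measure around [U `\` A]. *)
Lemma inner_approx (A : set (borel G)) (e : R) :
  measurable A -> (m A < +oo)%E -> 0 < e ->
  exists L : set G, [/\ compact L, L `<=` A & (m (A `\` L) < e%:E)%E].
Proof.
move=> mA Afin e0.
have e20 : 0 < e / 2 by rewrite divr_gt0.
have [U [oU AU mUA]] := outer_approx mA Afin (@ltr01 R).
have mU := open_borel oU.
have Ufin : (m U < +oo)%E.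
  rewrite -(setDUK AU) (le_lt_trans (measureU2 _ _ _))//; first exact: measurableD.
  by rewrite lte_add_pinfty// (lt_trans mUA)// ltry.
have [L [cL LU mUL]] := inner_approx_open oU Ufin e20.
have mL := compact_borel hG cL.
have mUDA : measurable (U `\` A : set (borel G)) by exact: measurableD.
have UDAfin : (m (U `\` A) < +oo)%E by rewrite (lt_trans mUA)// ltry.
have [V [oV UAV mV]] := outer_approx mUDA UDAfin e20.
have mVb := open_borel oV.
exists (L `\` V); split.
- rewrite setDE; apply: compact_closedI => //; exact: open_closedC.
- move=> x [Lx nVx]; apply: contrapT => nAx; apply: nVx; apply: UAV.
  by split => //; exact: LU.
- have sub : A `\` (L `\` V) `<=` (U `\` L) `|` (V `\` (U `\` A)).
    move=> x [Ax nLV]; have Ux := AU _ Ax.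
    have [Lx|nLx] := pselect (L x); last by left.
    right; split; last by case.
    by apply: contrapT => nVx; apply: nLV.
  apply: (@le_lt_trans _ _ (m ((U `\` L) `|` (V `\` (U `\` A))))).
    by apply: le_measure => //; rewrite inE; [do 2 (apply: measurableD => //)|
     apply: measurableU; do 2? (apply: measurableD => //)].
  apply: (le_lt_trans (measureU2 _ _ _)); try by do 2? (apply: measurableD => //).
  by rewrite [in ltRHS](splitr e) EFinD lteD.
Qed.

Lemma translateD (s t : G) (A : set G) : translate s (translate t A) = translate (t + s) A.
Proof.
rewrite !translate_preimage; apply/seteqP; split => x /=; rewrite opprD addrA addrAC//.
Qed.

Lemma translate0 (A : set G) : translate 0 A = A.
Proof. by rewrite translate_preimage; apply/seteqP; split => x /=; rewrite subr0. Qed.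

Lemma translate_setD (s : G) (A B : set G) :
  translate s (A `\` B) = translate s A `\` translate s B.
Proof. by rewrite !translate_preimage. Qed.

Lemma measure_translate (s : G) (A : set G) :
  measurable (A : set (borel G)) -> m (translate s A) = m A.
Proof. exact: haar_translate. Qed.

(** An open [U] around [A] with [m (U `\` A) < e] contains [translate u A] for
    all small [u], because [A] is compact. *)
Lemma translate_continuous_compact (A : set G) (e : R) : compact A -> 0 < e ->
  \forall u \near (0 : G), (m (translate (u : G) A `\` A) < e%:E)%E.
Proof.
move=> cA e0.
have mA := compact_borel hG cA.
have [U [oU AU mUA]] := outer_approx mA (haar_compact hm cA) e0.
have mU := open_borel oU.
have H : \forall u \near (0 : G), A `<=` (fun x => U (x + u)).
  apply: (proj1 (compact_near_coveringP A) cA) => x Ax.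
  have : nbhs (x + 0) U by rewrite addr0; apply: open_nbhs_nbhs; split => //; exact: AU.
  by move=> /(@add_continuous G (x, 0)).
near=> u.
apply: le_lt_trans mUA; apply: le_measure; rewrite ?inE.
- by apply: measurableD => //; exact: measurable_translate.
- exact: measurableD.
- move=> _ [[x Ax <-] nA]; split => //.
  by move: x Ax {nA}; near: u.
Unshelve. all: by end_near. Qed.

Lemma translate_continuous (A : set G) (e : R) :
  measurable (A : set (borel G)) -> (m A < +oo)%E -> 0 < e ->
  \forall u \near (0 : G), (m (translate (u : G) A `\` A) < e%:E)%E.
Proof.
move=> mA Afin e0.
have e20 : 0 < e / 2 by rewrite divr_gt0.
have [L [cL LA mAL]] := inner_approx mA Afin e20.
have mL := compact_borel hG cL.
near=> u.
have sub : translate u A `\` A `<=` translate u (A `\` L) `|` (translate u L `\` L).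
  rewrite translate_setD => x [uAx nAx].
  have [?|?] := pselect (translate u L x); last by left.
  by right; split => // /LA.
have m1 : measurable (translate u (A `\` L) : set (borel G)).
  by apply: measurable_translate; exact: measurableD.
have m2 : measurable (translate u L `\` L : set (borel G)).
  by apply: measurableD => //; exact: measurable_translate.
apply: (@le_lt_trans _ _ (m (translate u (A `\` L) `|` (translate u L `\` L)))).
  apply: le_measure => //; rewrite inE; last exact: measurableU.
  by apply: measurableD => //; exact: measurable_translate.
apply: (le_lt_trans (measureU2 _ m1 m2)).
rewrite [in ltRHS](splitr e) EFinD; apply: lteD.
  rewrite [ltLHS]measure_translate //; exact: measurableD.
by near: u; exact: translate_continuous_compact.
Unshelve. all: by end_near. Qed.

End Regularity.

(** * Exchanging the integrals of the indicator of a sheared set *)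

Section Shear.
Variables (R : realType) (G : topologicalZmodType).
Hypothesis hG : hausdorff_space G.
Variable m : {measure set (borel G) -> \bar R}.
Hypothesis hm : haar_measure m.
Local Notation emeas f := (@measurable_fun _ _ (borel G) (\bar R) setT f).
Variable sg : G -> G.
Hypothesis sg_cont : continuous sg.
Hypothesis sgD : forall x y, sg (x + y) = sg x + sg y.
Hypothesis sgK : involutive sg.

(** The two families of sections of [[set (x, t) | x + sg t \in E]].  Below, [sg]
    is the identity or the inversion of the group.  Since [sg] is an involutive
    automorphism, [x + sg t \in E] amounts to [t + sg x \in sg @^-1` E], so that
    sections in one direction are sections of a set of the same form in the
    other. *)
Definition slice (E : set G) (x : G) : set G := [set t | E (x + sg t)].
Definition coslice (E : set G) (t : G) : set G := [set x | E (x + sg t)].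

Lemma coslice_slice (E : set G) (t : G) : coslice E t = slice (sg @^-1` E) t.
Proof.
by apply/seteqP; split => x; rewrite /slice /coslice /= sgD sgK addrC.
Qed.

Lemma slice_coslice (E : set G) (x : G) : slice E x = coslice (sg @^-1` E) x.
Proof.
by apply/seteqP; split => t; rewrite /slice /coslice /= sgD sgK addrC.
Qed.

Lemma open_sg (E : set G) : open E -> open (sg @^-1` E).
Proof. by move: sg_cont => /continuousP; apply. Qed.

Lemma measurable_sg (E : set (borel G)) :
  measurable E -> measurable (sg @^-1` E : set (borel G)).
Proof.
by move=> mE; rewrite -[X in measurable X]setTI; apply: (continuous_borel sg_cont).
Qed.

Lemma measurable_slice (E : set (borel G)) (x : G) :
  measurable E -> measurable (slice E x : set (borel G)).
Proof.
move=> mE; rewrite -[X in measurable X]setTI.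
apply: (@continuous_borel _ (fun t : G => x + sg t)) => // t.
apply: (@continuous_comp _ _ _ sg (fun u : G => x + u)); first exact: sg_cont.
exact: continuous_addl.
Qed.

Lemma measurable_coslice (E : set (borel G)) (x : G) :
  measurable E -> measurable (coslice E x : set (borel G)).
Proof. by move=> mE; rewrite coslice_slice; apply: measurable_slice; exact: measurable_sg. Qed.

Lemma slice_translate (E : set G) (x : G) :
  slice E x = translate (- sg x) (sg @^-1` E).
Proof.
rewrite translate_preimage; apply/seteqP; split => t;
  by rewrite /slice /= opprK sgD sgK addrC.
Qed.

Lemma translate_setI (s : G) (A B : set G) :
  translate s (A `&` B) = translate s A `&` translate s B.
Proof. by rewrite !translate_preimage. Qed.

(** Moving the section by [sg x] leaves a fixed set [sg @^-1` E] and moves [C]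
    instead, whence the continuity in [x] that follows. *)
Lemma measure_setI_slice (C E : set G) (x : G) :
  measurable (C : set (borel G)) -> measurable (E : set (borel G)) ->
  m (C `&` slice E x) = m (translate (sg x) C `&` sg @^-1` E).
Proof.
move=> mC mE.
rewrite -(measure_translate hm (sg x)); last by apply: measurableI => //; exact: measurable_slice.
by rewrite translate_setI slice_translate translateD addNr translate0.
Qed.

Lemma measure_slice_near (C E : set G) (x0 : G) (e : R) :
  measurable (C : set (borel G)) -> (m C < +oo)%E -> measurable (E : set (borel G)) ->
  0 < e ->
  \forall x \near x0, (m (C `&` slice E x) <= m (C `&` slice E x0) + e%:E)%E /\
                      (m (C `&` slice E x0) <= m (C `&` slice E x) + e%:E)%E.
Proof.
move=> mC Cfin mE e0.
have step x y : (m (translate (sg x - sg y) C `\` C) < e%:E)%E ->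
    (m (C `&` slice E x) <= m (C `&` slice E y) + e%:E)%E.
  move=> H; rewrite !measure_setI_slice//.
  have mE' := measurable_sg mE.
  have mx := measurable_translate (sg x) mC.
  have my := measurable_translate (sg y) mC.
  apply: (@le_trans _ _ (m ((translate (sg y) C `&` sg @^-1` E) `|`
      (translate (sg x) C `\` translate (sg y) C)))).
    apply: le_measure; rewrite ?inE.
    - exact: measurableI.
    - by apply: measurableU; [exact: measurableI|exact: measurableD].
    - move=> t [t1 t2]; have [?|?] := pselect (translate (sg y) C t); first by left.
      by right.
  apply: (le_trans (measureU2 _ _ _)); [exact: measurableI|exact: measurableD|].
  rewrite leeD2l//.
  have -> : translate (sg x) C `\` translate (sg y) C =
            translate (sg y) (translate (sg x - sg y) C `\` C).
    by rewrite translate_setD translateD subrK.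
  rewrite [leLHS](measure_translate hm)//; first exact: ltW.
  by apply: measurableD => //; exact: measurable_translate.
have H := translate_continuous hG hm mC Cfin e0.
have c1 : (sg x - sg x0) @[x --> x0] --> (0 : G).
  rewrite -(subrr (sg x0)).
  exact: (@continuous_comp _ _ _ sg (fun u : G => u - sg x0) x0 (@sg_cont x0)
     (@continuous_addr G (- sg x0) (sg x0))).
have c2 : (sg x0 - sg x) @[x --> x0] --> (0 : G).
  have cN : {for x0, continuous (fun x => - sg x)}.
    exact: (@continuous_comp _ _ _ sg (@GRing.opp G) x0 (@sg_cont x0)
      (@opp_continuous G (sg x0))).
  rewrite -(subrr (sg x0)).
  exact: (@continuous_comp _ _ _ (fun x => - sg x) (fun u : G => sg x0 + u) x0 cN
     (@continuous_addl G (sg x0) (- sg x0))).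
near=> x; split; apply: step; near: x.
- exact: (c1 _ H).
- exact: (c2 _ H).
Unshelve. all: by end_near. Qed.

Lemma measurable_fun_slice (C E : set G) :
  measurable (C : set (borel G)) -> (m C < +oo)%E -> measurable (E : set (borel G)) ->
  emeas (fun x => m (C `&` slice E x)).
Proof.
move=> mC Cfin mE.
have Sfin x : m (C `&` slice E x) \is a fin_num.
  rewrite ge0_fin_numE// (le_lt_trans _ Cfin)// le_measure ?inE//.
  by apply: measurableI => //; exact: measurable_slice.
rewrite (_ : (fun x => _) = EFin \o (fun x : borel G => fine (m (C `&` slice E x)))); last first.
  by apply/funext => x /=; rewrite fineK.
apply/measurable_EFinP.
apply: (@continuous_measurable_real G R (fun x => fine (m (C `&` slice E x)))) => x0.
apply/cvgrPdist_le => e e0.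
near=> x.
have [h1 h2] : (m (C `&` slice E x) <= m (C `&` slice E x0) + e%:E)%E /\
                      (m (C `&` slice E x0) <= m (C `&` slice E x) + e%:E)%E.
  by near: x; exact: measure_slice_near.
move: h1 h2; rewrite -(fineK (Sfin x)) -(fineK (Sfin x0)) -!EFinD !lee_fin => h1 h2.
by rewrite ler_norml; apply/andP; split; lra.
Unshelve. all: by end_near. Qed.

Lemma measurable_fun_coslice (C E : set G) :
  measurable (C : set (borel G)) -> (m C < +oo)%E -> measurable (E : set (borel G)) ->
  emeas (fun x => m (C `&` coslice E x)).
Proof.
move=> mC Cfin mE; under eq_fun do rewrite coslice_slice.
by apply: measurable_fun_slice => //; exact: measurable_sg.
Qed.

(** One half of the exchange of integrals over [V], with error [e * m B].  It is
    required of all Borel subsets [B] of [V] so that it passes to unions. *)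
Definition shear_le (C E : set G) (e : R) (V : set G) : Prop :=
  forall B : set (borel G), measurable B -> (m B < +oo)%E -> B `<=` V ->
    (\int[m]_(x in B) m (C `&` slice E x) <=
     \int[m]_(t in C) m (B `&` coslice E t) + e%:E * m B)%E.

Lemma shear_leU (C E : set G) (e : R) (V W : set G) :
  measurable (C : set (borel G)) -> (m C < +oo)%E -> measurable (E : set (borel G)) ->
  0 < e -> measurable (V : set (borel G)) ->
  shear_le C E e V -> shear_le C E e W -> shear_le C E e (V `|` W).
Proof.
move=> mC Cfin mE e0 mV HV HW B mB Bfin BVW.
have mB1 : measurable (B `&` V : set (borel G)) by exact: measurableI.
have mB2 : measurable (B `\` V : set (borel G)) by exact: measurableD.
have B1fin : (m (B `&` V) < +oo)%E.
  by rewrite (le_lt_trans _ Bfin)// le_measure ?inE//; exact: subIsetl.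
have B2fin : (m (B `\` V) < +oo)%E.
  by rewrite (le_lt_trans _ Bfin)// le_measure ?inE//; exact: subDsetl.
have mF := measurable_fun_slice mC Cfin mE.
have {1}-> : B = (B `&` V) `|` (B `\` V) by rewrite setUIDK.
rewrite ge0_integral_setU//; last 2 first.
- exact: (measurable_funS _ _ mF).
- by rewrite disj_set2E; apply/eqP; rewrite setDE setIACA setICr setI0.
have -> : (\int[m]_(t in C) m (B `&` coslice E t) + e%:E * m B =
   (\int[m]_(t in C) m ((B `&` V) `&` coslice E t) + e%:E * m (B `&` V)) +
   (\int[m]_(t in C) m ((B `\` V) `&` coslice E t) + e%:E * m (B `\` V)))%E.
  rewrite addeACA; congr (_ + _)%E.
    rewrite -ge0_integralD//; last 2 first.
    - exact: (measurable_funS _ _ (measurable_fun_coslice mB1 B1fin mE)).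
    - exact: (measurable_funS _ _ (measurable_fun_coslice mB2 B2fin mE)).
    apply: eq_integral => t _.
    rewrite (measureDI m (measurableI _ _ mB (measurable_coslice _ mE)) mV).
    by rewrite addeC; congr (m _ + m _)%E; [rewrite setIAC|rewrite !setDE setIAC].
  by rewrite -ge0_muleDr// addeC -measureDI.
apply: leeD; first by apply: HV => //; exact: subIsetr.
by apply: HW => // x [Bx nVx]; have [] := BVW _ Bx.
Qed.

(** Near [x0], the part in [C] of every section contains one and the same compact
    set [L] and exceeds it by at most [e] in measure: over a neighbourhood [V] of
    [x0], the sheared set is close to the rectangle [V `*` L]. *)
Lemma shear_le_near (C E : set G) (e : R) (x0 : G) :
  measurable (C : set (borel G)) -> (m C < +oo)%E -> open E -> 0 < e ->
  exists V, open_nbhs x0 V /\ shear_le C E e V.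
Proof.
move=> mC Cfin oE e0.
have mE := open_borel oE.
have e20 : 0 < e / 2 by rewrite divr_gt0.
have mS : measurable (C `&` slice E x0 : set (borel G)).
  by apply: measurableI => //; exact: measurable_slice.
have Sfin : (m (C `&` slice E x0) < +oo)%E.
  by rewrite (le_lt_trans _ Cfin)// le_measure ?inE//; exact: subIsetl.
have [L [cL LS mL]] := inner_approx hG hm mS Sfin e20.
have mLb := compact_borel hG cL.
have H1 : \forall x \near x0, L `<=` (fun t => E (x + sg t)).
  apply: (proj1 (compact_near_coveringP L) cL) => t Lt.
  have : nbhs (x0 + sg t) E by apply: open_nbhs_nbhs; split => //; exact: (LS _ Lt).2.
  move=> /(@add_continuous G (x0, sg t)) [[P Q] /= [Px0 Qt] PQ].
  exists (sg @^-1` Q, P) => /=; first by split => //; exact: (sg_cont Qt).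
  by move=> [t' x] /= [Qt' Px]; apply: (PQ (x, sg t')).
have H2 := measure_slice_near x0 mC Cfin mE e20.
have : nbhs x0 [set x | L `<=` (fun t => E (x + sg t)) /\
    (m (C `&` slice E x) <= m L + e%:E)%E].
  near=> x; split; first by near: x.
  have [h _] : (m (C `&` slice E x) <= m (C `&` slice E x0) + (e / 2)%:E)%E /\
    (m (C `&` slice E x0) <= m (C `&` slice E x) + (e / 2)%:E)%E by near: x.
  apply: (le_trans h).
  rewrite [in leRHS](splitr e) EFinD addeA leeD2r//.
  rewrite (measureDI m mS mLb) (setIidr LS) [leRHS]addeC.
  by apply: leeD => //; exact: ltW.
rewrite nbhsE => -[V [oV Vx0] VP].
exists V; split => // B mB Bfin BV.
apply: (@le_trans _ _ (\int[m]_(x in B) (cst (m L + e%:E) x))%E).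
  apply: ge0_le_integral => //.
  - exact: (measurable_funS _ _ (measurable_fun_slice mC Cfin mE)).
  - by move=> x /BV /VP[].
rewrite integral_cst// ge0_muleDl//; last by rewrite lee_fin ltW.
apply: leeD => //.
rewrite muleC -integral_cst//.
apply: (@le_trans _ _ (\int[m]_(x in L) m (B `&` coslice E x))%E).
  apply: ge0_le_integral => //.
  - exact: (measurable_funS _ _ (measurable_fun_coslice mB Bfin mE)).
  - move=> t Lt; rewrite setIidl// => x /BV /VP [+ _]; exact.
apply: ge0_subset_integral => //.
- exact: (measurable_funS _ _ (measurable_fun_coslice mB Bfin mE)).
- by move=> t /LS[].
Unshelve. all: by end_near. Qed.

(** Finitely many of the neighbourhoods given by [shear_le_near] cover [K]. *)
Lemma shear_le_compact (C E : set G) (e : R) (K : set G) :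
  measurable (C : set (borel G)) -> (m C < +oo)%E -> open E -> 0 < e ->
  compact K -> shear_le C E e K.
Proof.
move=> mC Cfin oE e0 cK.
have mE := open_borel oE.
have /choice [V HV] : forall x : G, exists V, open_nbhs x V /\ shear_le C E e V.
  by move=> x; exact: shear_le_near.
have cK' : @cover_compact G K by have := cK; rewrite (@compact_cover (borel G)).
have [] := cK' G setT V.
- by move=> x _; have [[]] := HV x.
- by move=> x _; exists x => //; have [[]] := HV x.
move=> D _ KD.
have Hs : forall s : seq G, shear_le C E e (\big[setU/set0]_(x <- s) V x).
  elim => [|x s IH].
    rewrite big_nil => B mB Bfin; rewrite subset0 => ->.
    by rewrite integral_set0 measure0 mule0 adde0 integral_ge0.
  rewrite big_cons; apply: shear_leU => //; last exact: (HV x).2.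
  by apply: open_borel; have [[]] := HV x.
move=> B mB Bfin BK; apply: (Hs (finmap.enum_fset D) B mB Bfin).
by apply: (subset_trans BK); rewrite -bigcup_seq; exact: KD.
Qed.

Lemma shear_le_open (A C E : set G) :
  measurable (A : set (borel G)) -> (m A < +oo)%E ->
  measurable (C : set (borel G)) -> (m C < +oo)%E -> open E ->
  (\int[m]_(x in A) m (C `&` slice E x) <= \int[m]_(t in C) m (A `&` coslice E t))%E.
Proof.
move=> mA Afin mC Cfin oE.
have mE := open_borel oE.
apply/lee_addgt0Pr => e e0.
pose a := fine (m A); pose c := fine (m C).
have aE : m A = a%:E by rewrite fineK// ge0_fin_numE.
have cE : m C = c%:E by rewrite fineK// ge0_fin_numE.
have a0 : 0 <= a by rewrite fine_ge0.
have c0 : 0 <= c by rewrite fine_ge0.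
(* With errors [d * a] over [L] and [d * c] over [A `\` L], the total error is at most [e]. *)
pose d := e / (a + c + 1).
have d0 : 0 < d by rewrite divr_gt0// ltr_wpDl// addr_ge0.
have [L [cL LA mL]] := inner_approx hG hm mA Afin d0.
have mLb := compact_borel hG cL.
have Lfin := haar_compact hm cL.
have LleA : (m L <= m A)%E by rewrite le_measure ?inE.
have H := shear_le_compact mC Cfin oE d0 cL mLb Lfin (@subset_refl _ L).
have mF := measurable_fun_slice mC Cfin mE.
rewrite -{1}(setDUK LA) ge0_integral_setU//; last 3 first.
- exact: measurableD.
- exact: (measurable_funS _ _ mF).
- by rewrite disj_set2E setDIK.
have H2 : (\int[m]_(x in A `\` L) m (C `&` slice E x) <= d%:E * c%:E)%E.
  apply: (@le_trans _ _ (\int[m]_(x in A `\` L) (cst (m C) x))%E).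
    apply: ge0_le_integral => //.
    - exact: measurableD.
    - exact: (measurable_funS _ _ mF).
    - move=> x _; rewrite le_measure ?inE//.
      by apply: measurableI => //; exact: measurable_slice.
  rewrite integral_cst; last exact: measurableD.
  rewrite cE muleC; apply: lee_wpmul2r; rewrite ?lee_fin//; exact: ltW.
have H3 : (\int[m]_(t in C) m (L `&` coslice E t) <=
           \int[m]_(t in C) m (A `&` coslice E t))%E.
  apply: ge0_le_integral => //.
  - exact: (measurable_funS _ _ (measurable_fun_coslice mLb Lfin mE)).
  - exact: (measurable_funS _ _ (measurable_fun_coslice mA Afin mE)).
  - move=> t _; apply: le_measure; rewrite ?inE.
    + by apply: measurableI => //; exact: measurable_coslice.
    + by apply: measurableI => //; exact: measurable_coslice.
    + exact: setSI.
apply: (le_trans (leeD H H2)).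
rewrite -addeA; apply: leeD => //.
apply: (@le_trans _ _ (d%:E * a%:E + d%:E * c%:E)%E).
  by rewrite leeD2r// -aE; apply: lee_wpmul2l => //; rewrite lee_fin ltW.
rewrite -!EFinM -EFinD lee_fin -mulrDr /d mulrAC ler_pdivrMr ?ltr_wpDl ?addr_ge0//.
by rewrite ler_pM2l// lerDl.
Qed.

(** Exchanging the roles of [x] and [t] turns the inequality into its converse. *)
Lemma shear_eq_open (A C E : set G) :
  measurable (A : set (borel G)) -> (m A < +oo)%E ->
  measurable (C : set (borel G)) -> (m C < +oo)%E -> open E ->
  (\int[m]_(x in A) m (C `&` slice E x) = \int[m]_(t in C) m (A `&` coslice E t))%E.
Proof.
move=> mA Afin mC Cfin oE; apply/eqP; rewrite eq_le shear_le_open//=.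
have := shear_le_open mC Cfin mA Afin (open_sg oE).
under eq_integral do rewrite -coslice_slice.
by under [X in (_ <= X)%E -> _]eq_integral do rewrite -slice_coslice.
Qed.

(** The class of sets for which the exchange holds is a Dynkin system, and the
    open sets form a pi-system which generates the Borel sets. *)
Lemma shear_eq (A C E : set G) :
  measurable (A : set (borel G)) -> (m A < +oo)%E ->
  measurable (C : set (borel G)) -> (m C < +oo)%E ->
  measurable (E : set (borel G)) ->
  (\int[m]_(x in A) m (C `&` slice E x) = \int[m]_(t in C) m (A `&` coslice E t))%E.
Proof.
move=> mA Afin mC Cfin.
pose H := [set E : set G | measurable (E : set (borel G)) /\
  (\int[m]_(x in A) m (C `&` slice E x) = \int[m]_(t in C) m (A `&` coslice E t))%E].
suff sub : <<s (@open G) >> `<=` H by move=> mE; have [] := sub E mE.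
apply: lambda_system_subset => //; first exact: openI.
  apply/dynkin_lambda_system; split.
  - by split => //; apply: shear_eq_open => //; exact: openT.
  - move=> F [mF eqF]; split; first exact: measurableC.
    have mF' : measurable (~` F : set (borel G)) by exact: measurableC.
    have eqA : (\int[m]_(x in A) m (C `&` slice F x) +
        \int[m]_(x in A) m (C `&` slice (~` F) x) = m C * m A)%E.
      rewrite -ge0_integralD//; last 2 first.
      + exact: (measurable_funS _ _ (measurable_fun_slice mC Cfin mF)).
      + exact: (measurable_funS _ _ (measurable_fun_slice mC Cfin mF')).
      rewrite -integral_cst//; apply: eq_integral => x _ /=.
      by rewrite [RHS](measureDI m mC (measurable_slice x mF)) addeC setDE.
    have eqC : (\int[m]_(x in C) m (A `&` coslice F x) +
        \int[m]_(x in C) m (A `&` coslice (~` F) x) = m C * m A)%E.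
      rewrite -ge0_integralD//; last 2 first.
      + exact: (measurable_funS _ _ (measurable_fun_coslice mA Afin mF)).
      + exact: (measurable_funS _ _ (measurable_fun_coslice mA Afin mF')).
      rewrite muleC -integral_cst//; apply: eq_integral => x _ /=.
      by rewrite [RHS](measureDI m mA (measurable_coslice x mF)) addeC setDE.
    have CAfin : (m C * m A < +oo)%E.
      by rewrite lte_mul_pinfty// ge0_fin_numE.
    have Ffin : (\int[m]_(x in C) m (A `&` coslice F x))%E \is a fin_num.
      rewrite ge0_fin_numE ?integral_ge0//.
      by apply: le_lt_trans CAfin; rewrite -eqC leeDl// integral_ge0.
    move: eqA; rewrite -eqC eqF ![(\int[m]_(x in C) m (A `&` coslice F x) + _)%E]addeC.
    by move/(congr1 (fun z => z - \int[m]_(x in C) m (A `&` coslice F x))%E); rewrite !addeK.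
  - move=> F tF HF; split; first by apply: bigcupT_measurable => n; have [] := HF n.
    have mF n : measurable (F n : set (borel G)) by have [] := HF n.
    transitivity (\int[m]_(x in A) (\sum_(n <oo) m (C `&` slice (F n) x)))%E.
      apply: eq_integral => x _.
      rewrite -[LHS](_ : m (\bigcup_n (C `&` slice (F n) x)) = _).
        rewrite measure_semi_bigcup//.
        + by move=> n; apply: measurableI => //; exact: measurable_slice.
        + apply/trivIsetP => i j _ _ ij.
          move/trivIsetP : tF => /(_ i j I I ij) /seteqP [Fij _].
          by apply/seteqP; split => // t [[_ t1] [_ t2]]; exact: (Fij (x + sg t)).
        + apply: bigcupT_measurable => n.
          by apply: measurableI => //; exact: measurable_slice.
      by rewrite -setI_bigcupr; congr (m (_ `&` _)); apply/seteqP; split => t [n _ h]; exists n.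
    rewrite integral_nneseries//; last first.
      by move=> n; exact: (measurable_funS _ _ (measurable_fun_slice mC Cfin (mF n))).
    transitivity (\int[m]_(x in C) (\sum_(n <oo) m (A `&` coslice (F n) x)))%E; last first.
      apply: eq_integral => x _.
      rewrite -[RHS](_ : m (\bigcup_n (A `&` coslice (F n) x)) = _).
        rewrite measure_semi_bigcup//.
        + by move=> n; apply: measurableI => //; exact: measurable_coslice.
        + apply/trivIsetP => i j _ _ ij.
          move/trivIsetP : tF => /(_ i j I I ij) /seteqP [Fij _].
          by apply/seteqP; split => // t [[_ t1] [_ t2]]; exact: (Fij (t + sg x)).
        + apply: bigcupT_measurable => n.
          by apply: measurableI => //; exact: measurable_coslice.
      by rewrite -setI_bigcupr; congr (m (_ `&` _)); apply/seteqP; split => t [n _ h]; exists n.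
    rewrite integral_nneseries//; last first.
      by move=> n; exact: (measurable_funS _ _ (measurable_fun_coslice mA Afin (mF n))).
    by apply: eq_eseriesr => n _; have [] := HF n.
move=> U oU; split; first exact: open_borel.
exact: shear_eq_open.
Qed.

End Shear.

(** * Functions whose iterated integrals agree *)

Section Swap.
Variables (R : realType) (G : topologicalZmodType).
Variable m : {measure set (borel G) -> \bar R}.
Local Notation emeas f := (@measurable_fun _ _ (borel G) (\bar R) setT f).
Local Open Scope ereal_scope.

(** The iterated integrals of [F] over [A] and [G] are defined and agree in both
    orders.  This class is closed under the operations which build functions
    from indicators, and it does not refer to a sigma-algebra on [G * G]. *)
Record swappable (A : set G) (F : G -> G -> \bar R) : Prop := Swappable {
  swap_ge0 : forall x t, 0 <= F x t ;
  swap_meas1 : forall x, emeas (F x) ;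
  swap_meas2 : forall t, emeas (F ^~ t) ;
  swap_int1 : emeas (fun x => \int[m]_t F x t) ;
  swap_int2 : emeas (fun t => \int[m]_(x in A) F x t) ;
  swap_eq : \int[m]_(x in A) \int[m]_t F x t = \int[m]_t \int[m]_(x in A) F x t }.

Variable A : set G.
Hypothesis mA : measurable (A : set (borel G)).

Lemma swappable0 : swappable A (fun _ _ => 0).
Proof.
have mc : emeas (fun=> 0) by exact: measurable_cst.
have i0 (D : set (borel G)) : \int[m]_(x in D) 0 = 0 by exact: integral0.
by split=> //; rewrite ?i0.
Qed.

Lemma swappableZ (r : R) F : (0 <= r)%R -> swappable A F ->
  swappable A (fun x t => r%:E * F x t).
Proof.
move=> r0 [F0 m1 m2 i1 i2 e].
have e1 x : \int[m]_t (r%:E * F x t) = r%:E * \int[m]_t F x t.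
  by rewrite ge0_integralZl_EFin.
have e2 t : \int[m]_(x in A) (r%:E * F x t) = r%:E * \int[m]_(x in A) F x t.
  by rewrite ge0_integralZl_EFin//; exact: measurable_funS (m2 t).
split.
- by move=> x t; rewrite mule_ge0// lee_fin.
- by move=> x; exact: measurable_funeM.
- by move=> t; exact: measurable_funeM.
- by under eq_fun do rewrite e1; exact: measurable_funeM.
- by under eq_fun do rewrite e2; exact: measurable_funeM.
- under eq_integral do rewrite e1.
  under [RHS]eq_integral do rewrite e2.
  rewrite !ge0_integralZl_EFin ?e//.
  + by move=> t _; apply: integral_ge0.
  + by move=> x _; apply: integral_ge0.
  + exact: measurable_funS i1.
Qed.

Lemma swappable_sum (I : Type) (s : seq I) (F : I -> G -> G -> \bar R) :
  (forall i, swappable A (F i)) -> swappable A (fun x t => \sum_(i <- s) F i x t).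
Proof.
move=> H.
have F0 i x t : 0 <= F i x t by have [] := H i.
have m1 i x : emeas (F i x) by have [] := H i.
have m2 i t : emeas (F i ^~ t) by have [] := H i.
have i1 i : emeas (fun x => \int[m]_t F i x t) by have [] := H i.
have i2 i : emeas (fun t => \int[m]_(x in A) F i x t) by have [] := H i.
have e1 x : \int[m]_t (\sum_(i <- s) F i x t) = \sum_(i <- s) \int[m]_t F i x t.
  by rewrite ge0_integral_sum.
have e2 t : \int[m]_(x in A) (\sum_(i <- s) F i x t) =
            \sum_(i <- s) \int[m]_(x in A) F i x t.
  by rewrite ge0_integral_sum// => i; exact: measurable_funS (m2 i t).
split.
- by move=> x t; apply: sume_ge0.
- by move=> x; exact: emeasurable_sum.
- by move=> t; exact: emeasurable_sum.
- by under eq_fun do rewrite e1; exact: emeasurable_sum.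
- by under eq_fun do rewrite e2; exact: emeasurable_sum.
- under eq_integral do rewrite e1.
  under [RHS]eq_integral do rewrite e2.
  rewrite !ge0_integral_sum//.
  + by apply: eq_bigr => i _; have [] := H i.
  + by move=> i x _; apply: integral_ge0.
  + by move=> i; exact: measurable_funS (i1 i).
  + by move=> i x _; apply: integral_ge0.
Qed.

(** Monotone convergence, applied to the inner and then to the outer
    integrals. *)
Lemma swappable_lim (Fn : nat -> G -> G -> \bar R) (F : G -> G -> \bar R) :
  (forall n, swappable A (Fn n)) ->
  (forall x t, nondecreasing_seq (fun n => Fn n x t)) ->
  (forall x t, Fn n x t @[n --> \oo] --> F x t) ->
  swappable A F.
Proof.
move=> H nd cv.
have F0 n x t : 0 <= Fn n x t by have [] := H n.
have m1 n x : emeas (Fn n x) by have [] := H n.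
have m2 n t : emeas (Fn n ^~ t) by have [] := H n.
have m2A n t : measurable_fun (A : set (borel G)) (Fn n ^~ t).
  exact: measurable_funS (m2 n t).
have i1 n : emeas (fun x => \int[m]_t Fn n x t) by have [] := H n.
have i1A n : @measurable_fun _ _ (borel G) (\bar R) A (fun x => \int[m]_t Fn n x t).
  exact: measurable_funS (i1 n).
have i2 n : emeas (fun t => \int[m]_(x in A) Fn n x t) by have [] := H n.
have FE x t : F x t = limn (fun n => Fn n x t) by apply/esym/cvg_lim.
have c1 x : \int[m]_t Fn n x t @[n --> \oo] --> \int[m]_t F x t.
  under eq_integral do rewrite FE.
  by apply: cvg_monotone_convergence => // t _ a b ab; exact: nd.
have c2 t : \int[m]_(x in A) Fn n x t @[n --> \oo] --> \int[m]_(x in A) F x t.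
  under eq_integral do rewrite FE.
  by apply: cvg_monotone_convergence => // x _ a b ab; exact: nd.
split.
- by move=> x t; rewrite FE; apply: lime_ge; [apply/cvg_ex; exists (F x t)|exact: nearW].
- by move=> x; apply: (@emeasurable_fun_cvg _ (borel G) R setT (fun n => Fn n x)) => // t _; exact: cv.
- by move=> t; apply: (@emeasurable_fun_cvg _ (borel G) R setT (fun n => Fn n ^~ t)) => // x _; exact: cv.
- by apply: (@emeasurable_fun_cvg _ (borel G) R setT (fun n x => \int[m]_t Fn n x t)) => // x _; exact: c1.
- by apply: (@emeasurable_fun_cvg _ (borel G) R setT (fun n t => \int[m]_(x in A) Fn n x t)) => // x _; exact: c2.
- have d1 : \int[m]_(x in A) \int[m]_t Fn n x t @[n --> \oo] -->
            \int[m]_(x in A) \int[m]_t F x t.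
    rewrite (_ : \int[m]_(x in A) \int[m]_t F x t =
      \int[m]_(x in A) limn (fun n => \int[m]_t Fn n x t)); last first.
      by apply: eq_integral => x _; apply/esym/cvg_lim => //; exact: c1.
    apply: cvg_monotone_convergence => //.
    + by move=> n x _; apply: integral_ge0.
    + by move=> x _ a b ab; apply: ge0_le_integral => // t _; exact: nd.
  have d2 : \int[m]_t \int[m]_(x in A) Fn n x t @[n --> \oo] -->
            \int[m]_t \int[m]_(x in A) F x t.
    rewrite (_ : \int[m]_t \int[m]_(x in A) F x t =
      \int[m]_t limn (fun n => \int[m]_(x in A) Fn n x t)); last first.
      by apply: eq_integral => x _; apply/esym/cvg_lim => //; exact: c2.
    apply: cvg_monotone_convergence => //.
    + by move=> n x _; apply: integral_ge0.
    + by move=> x _ a b ab; apply: ge0_le_integral => // t _; exact: nd.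
  move: d1; under eq_fun do rewrite swap_eq//.
  move=> d1; move/cvg_lim : d1 => <- //; by move/cvg_lim : d2 => <-.
Qed.

End Swap.

(** * Exchanging the integrals of a product f(t) th(x + t) or f(t) th(x - t) *)

Section ShearSwap.
Variables (R : realType) (G : topologicalZmodType).
Hypothesis hG : hausdorff_space G.
Variable m : {measure set (borel G) -> \bar R}.
Hypothesis hm : haar_measure m.
Local Notation emeas f := (@measurable_fun _ _ (borel G) (\bar R) setT f).
Variable sg : G -> G.
Hypothesis sg_cont : continuous sg.
Hypothesis sgD : forall x y, sg (x + y) = sg x + sg y.
Hypothesis sgK : involutive sg.
Variable A : set G.
Hypothesis mA : measurable (A : set (borel G)).
Hypothesis Afin : (m A < +oo)%E.

Lemma swappable_indic (C E : set G) :
  measurable (C : set (borel G)) -> (m C < +oo)%E -> measurable (E : set (borel G)) ->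
  swappable m A (fun x t => (\1_C t * \1_E (x + sg t))%:E).
Proof.
move=> mC Cfin mE.
have F1 x : (fun t => (\1_C t * \1_E (x + sg t))%:E : \bar R) =
    EFin \o \1_(C `&` slice sg E x).
  by apply/funext => t /=; rewrite indicI.
have F2 t : (fun x => (\1_C t * \1_E (x + sg t))%:E : \bar R) =
    (fun x => (\1_C t)%:E * (\1_(coslice sg E t) x)%:E)%E.
  by apply/funext => x /=; rewrite EFinM.
have mS x : measurable (C `&` slice sg E x : set (borel G)).
  by apply: measurableI => //; exact: measurable_slice.
have mT t : measurable (coslice sg E t : set (borel G)) by exact: measurable_coslice.
have C0 t : 0 <= \1_C t :> R by rewrite indicE.
have I1 x : (\int[m]_t (\1_C t * \1_E (x + sg t))%:E = m (C `&` slice sg E x))%E.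
  by rewrite [LHS](_ : _ = \int[m]_t (EFin \o \1_(C `&` slice sg E x)) t)%E -?F1//
    F1 integral_indic// setIT.
have I2 t : (\int[m]_(x in A) (\1_C t * \1_E (x + sg t))%:E =
    (\1_C t)%:E * m (A `&` coslice sg E t))%E.
  rewrite [LHS](_ : _ = \int[m]_(x in A) ((\1_C t)%:E * (\1_(coslice sg E t) x)%:E))%E;
    last by apply: eq_integral => x _; exact: (congr1 (@^~ x) (F2 t)).
  rewrite ge0_integralZl_EFin//; last first.
    by apply/measurable_EFinP; exact: measurable_indic.
  by rewrite integral_indic// setIC.
have mI2 : emeas (fun t => (\1_C t)%:E * m (A `&` coslice sg E t))%E.
  apply: emeasurable_funM; first by apply/measurable_EFinP; exact: measurable_indic.
  exact: measurable_fun_coslice.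
split.
- by move=> x t; rewrite lee_fin mulr_ge0// indicE.
- by move=> x; rewrite F1; apply/measurable_EFinP; exact: measurable_indic.
- move=> t; rewrite F2; apply: measurable_funeM; apply/measurable_EFinP.
  exact: measurable_indic.
- by under eq_fun do rewrite I1; exact: measurable_fun_slice.
- by under eq_fun do rewrite I2.
- under eq_integral do rewrite I1.
  under [RHS]eq_integral do rewrite I2.
  rewrite (shear_eq hG hm sg_cont sgD sgK)// [LHS]integral_mkcond.
  apply: eq_integral => t _; rewrite patchE indicE.
  by case: ifPn; rewrite ?mul1e ?mul0e.
Qed.

Import HBNNSimple.

(** The terms are indexed by an ordinal so that every index, and not only those
    of a list, satisfies the side conditions; [swappable_sum] asks for this. *)
Lemma nnsfun_sum (h : {nnsfun borel G >-> R}) :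
  exists n (c : 'I_n -> R) (D : 'I_n -> set G),
  [/\ forall i, 0 <= c i, forall i, measurable (D i : set (borel G)),
      forall i x, D i x -> h x = c i &
      forall x : G, h x = \sum_(i < n) c i * \1_(D i) x].
Proof.
pose s := fset_set (range h).
exists #|`s|, (fun i => s`_i), (fun i => h @^-1` [set s`_i]); split => //.
- move=> i; have : s`_i \in s by rewrite mem_nth.
  by rewrite in_fset_set// => /set_mem [x _ <-].
by move=> x; rewrite {1}fimfunEord.
Qed.

(** Integrability of [f] makes its level sets of nonzero value sets of finite
    measure. *)
Lemma swappable_nnsfun (f th : {nnsfun borel G >-> R}) :
  (\int[m]_t (f t)%:E < +oo)%E ->
  swappable m A (fun x t => (f t * th (x + sg t))%:E).
Proof.
move=> ffin.
have [n [c [D [c0 mD Dc fE]]]] := nnsfun_sum f.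
have [n' [c' [D' [c0' mD' Dc' fE']]]] := nnsfun_sum th.
have -> : (fun x t => (f t * th (x + sg t))%:E : \bar R) =
  (fun x t => \sum_(i < n) \sum_(j < n') (c i * c' j)%:E *
     (\1_(D i) t * \1_(D' j) (x + sg t))%:E)%E.
  apply/funext => x; apply/funext => t.
  rewrite (fE t) (fE' (x + sg t)) mulr_suml -sumEFin; apply: eq_bigr => i _.
  rewrite mulr_sumr -sumEFin; apply: eq_bigr => j _.
  by rewrite -EFinM mulrACA.
apply: (swappable_sum mA) => i; apply: (swappable_sum mA) => j.
have [ci0|ci0] := eqVneq (c i) 0.
  rewrite (_ : (fun x t => _) = (fun _ _ => 0%E)); first exact: swappable0.
  by apply/funext => x; apply/funext => t; rewrite ci0 mul0r mul0e.
apply: swappableZ => //; first by rewrite mulr_ge0.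
apply: swappable_indic => //.
have ci : 0 < c i by rewrite lt0r ci0 c0.
have : ((c i)%:E * m (D i) <= \int[m]_t (f t)%:E)%E.
  rewrite -integral_cst//; apply: (@le_trans _ _ (\int[m]_(t in D i) (f t)%:E)%E).
    apply: ge0_le_integral => //.
    - by move=> x _; rewrite lee_fin.
    - exact/measurable_EFinP/measurable_funTS.
    - by move=> x Dx /=; rewrite (Dc i x Dx).
  apply: ge0_subset_integral => //.
  - exact/measurable_EFinP.
  - by move=> x _; rewrite lee_fin.
move=> /le_lt_trans/(_ ffin) h.
by move: h; rewrite !ltey; apply: contra_neq => ->; rewrite gt0_muley// lte_fin.
Qed.

Lemma swappable_mul (f th : G -> R) :
  measurable_fun (setT : set (borel G)) (f : borel G -> R) -> (forall t, 0 <= f t) ->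
  (\int[m]_t (f t)%:E < +oo)%E ->
  measurable_fun (setT : set (borel G)) (th : borel G -> R) -> (forall t, 0 <= th t) ->
  swappable m A (fun x t => (f t * th (x + sg t))%:E).
Proof.
move=> mf f0 ffin mth th0.
have mf' : emeas (EFin \o f) by exact/measurable_EFinP.
have mth' : emeas (EFin \o th) by exact/measurable_EFinP.
pose fn := nnsfun_approx measurableT mf'.
pose tn := nnsfun_approx measurableT mth'.
have cf x : (fn n x)%:E @[n --> \oo] --> (f x)%:E.
  apply: (@cvg_nnsfun_approx _ (borel G) R setT measurableT (EFin \o f) mf') => //.
  by move=> y _; rewrite lee_fin.
have ct x : (tn n x)%:E @[n --> \oo] --> (th x)%:E.
  apply: (@cvg_nnsfun_approx _ (borel G) R setT measurableT (EFin \o th) mth') => //.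
  by move=> y _; rewrite lee_fin.
have nf x : nondecreasing_seq (fun n => fn n x).
  by move=> a b ab; apply/lefP: x; exact: nd_nnsfun_approx.
have nt x : nondecreasing_seq (fun n => tn n x).
  by move=> a b ab; apply/lefP: x; exact: nd_nnsfun_approx.
have fn_le n x : fn n x <= f x.
  rewrite -lee_fin -(cvg_lim _ (cf x))//; apply: lime_ge.
    by apply/cvg_ex; exists (f x)%:E; exact: cf.
  by exists n => // k /= nk; rewrite lee_fin; exact: nf.
apply: (@swappable_lim _ _ _ _ mA (fun n x t => (fn n t * tn n (x + sg t))%:E)).
- move=> n; apply: swappable_nnsfun.
  apply: le_lt_trans ffin; apply: ge0_le_integral => //.
  + by move=> x _; rewrite lee_fin.
  + exact/measurable_EFinP.
  + by move=> x _; rewrite lee_fin.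
- by move=> x t a b ab; rewrite lee_fin ler_pM//; [exact: nf|exact: nt].
- move=> x t; rewrite EFinM; under eq_fun do rewrite EFinM.
  by apply: cvgeM => //.
Qed.

End ShearSwap.

(** * Invariance of Haar measure under inversion *)

Section Inversion.
Variables (R : realType) (G : topologicalZmodType).
Hypothesis hG : hausdorff_space G.
Variable m : {measure set (borel G) -> \bar R}.
Hypothesis hm : haar_measure m.

Lemma id_continuous : continuous (id : G -> G).
Proof. by move=> x; exact: cvg_id. Qed.

Lemma neg_continuous : continuous (-%R : G -> G).
Proof. exact: opp_continuous. Qed.

Lemma compact_neg (K : set G) : compact K -> compact (-%R @^-1` K).
Proof.
move=> cK; rewrite (_ : _ @^-1` _ = -%R @` K); last first.
  by apply/seteqP; split => [x Kx|_ [x Kx <-]] /=; [exists (- x); rewrite ?opprK|rewrite opprK].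
apply: continuous_compact => //.
by apply: continuous_subspaceT; exact: neg_continuous.
Qed.

Lemma compact_add (K L : set G) : compact K -> compact L ->
  compact [set x.1 + x.2 | x in K `*` L].
Proof.
move=> cK cL; apply: continuous_compact; last exact: compact_setX.
by apply: continuous_subspaceT; exact: add_continuous.
Qed.

Lemma neg_measurable (E : set (borel G)) :
  measurable E -> measurable (-%R @^-1` E : set (borel G)).
Proof. exact: (measurable_sg neg_continuous). Qed.

Lemma compact_pos_exists : exists C : set G, compact C /\ (0 < m C)%E.
Proof.
apply: contrapT => h.
have := haar_neq0 hm; rewrite (haar_inner hm openT); apply/negP; rewrite negbK.
rewrite eq_le; apply/andP; split.
  apply: ge_ereal_sup => _ [C [cC _] <-]; rewrite leNgt; apply/negP => mC.
  by apply: h; exists C.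
apply: ereal_sup_ubound; exists set0; last by rewrite measure0.
by split => //; exact: compact0.
Qed.

(** Choose a compact [C] with [0 < m C]. The measure of
    [[set (x, t) | t \in C, x - t \in E]] is [m E * m C] when [x] is integrated
    first.  Its section at [x], translated by [- x], is
    [[set t | t \in - E, x + t \in C]], and the measure of the set with these
    sections is [m C * m (- E)] when [x] is integrated first. *)
Lemma measure_neg_compact (E : set G) : compact E -> m (-%R @^-1` E) = m E.
Proof.
move=> cE; have [C [cC C0]] := compact_pos_exists.
have cK := compact_add cC cE; set K := [set _ | _ in _] in cK.
have cE' := compact_neg cE; set E' := -%R @^-1` E in cE' *.
have mC := compact_borel hG cC; have Cfin := haar_compact hm cC.
have mE := compact_borel hG cE; have Efin := haar_compact hm cE.
have mK := compact_borel hG cK; have Kfin := haar_compact hm cK.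
have mE' := compact_borel hG cE'; have E'fin := haar_compact hm cE'.
have S1 := shear_eq hG hm neg_continuous (@opprD G) (@opprK G) mK Kfin mC Cfin mE.
have S2 := shear_eq hG hm id_continuous (fun _ _ => erefl) (fun _ => erefl) mK Kfin mE' E'fin mC.
have e1 : (\int[m]_(t in C) m (K `&` coslice -%R E t) = m E * m C)%E.
  rewrite -integral_cst//; apply: eq_integral => t /set_mem Ct /=.
  rewrite -(measure_translate hm t mE); congr (m _).
  rewrite translate_preimage; apply/seteqP; split => [x [] //|x Ex]; split => //.
  by exists (t, x - t) => //=; rewrite addrC subrK.
have e2 : (\int[m]_(t in E') m (K `&` coslice id C t) = m C * m E')%E.
  rewrite -integral_cst//; apply: eq_integral => t /set_mem Et /=.
  rewrite -(measure_translate hm (- t) mC); congr (m _).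
  rewrite translate_preimage opprK; apply/seteqP; split => [x [] //|x Ex]; split => //.
  by exists (x + t, - t) => //=; rewrite addrK.
have e3 : (\int[m]_(x in K) m (C `&` slice -%R E x) =
           \int[m]_(x in K) m (E' `&` slice id C x))%E.
  apply: eq_integral => x _.
  rewrite -(measure_translate hm (- x)); last first.
    by apply: measurableI => //; exact: (measurable_slice neg_continuous).
  congr (m _); rewrite translate_preimage opprK; apply/seteqP; split => t [];
    by rewrite /slice /E' /= opprD addrCA subrr addr0 addrC.
move: S1; rewrite e3 S2 e1 e2 muleC => /esym.
have mCfin : m C \is a fin_num by rewrite ge0_fin_numE.
move=> h.
have := congr1 (fun z => (z * (fine (m C))^-1%:E)%E) h.
rewrite /= -!muleA.
have -> : (m C * ((fine (m C))^-1)%:E = 1)%E.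
  rewrite -{1}(fineK mCfin) -EFinM mulfV//.
  by rewrite gt_eqF// fine_gt0// C0 Cfin.
by rewrite !mule1 => ->.
Qed.

Lemma neg_negK (A : set G) : -%R @^-1` (-%R @^-1` A) = A.
Proof. by apply/seteqP; split => x /=; rewrite opprK. Qed.

(** Inversion permutes the compact sets, which determine the measure of open sets. *)
Lemma measure_neg_open (U : set G) : open U -> m (-%R @^-1` U) = m U.
Proof.
have le V : open V -> (m V <= m (-%R @^-1` V))%E.
  move=> oV; rewrite (haar_inner hm oV).
  apply: ge_ereal_sup => _ [L [cL LV] <-].
  rewrite -(measure_neg_compact cL); apply: le_measure; [apply: mem_set|apply: mem_set|].
    - exact: (neg_measurable (compact_borel hG cL)).
  - exact: (neg_measurable (open_borel oV)).
  - by move=> x /LV.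
move=> oU; apply/eqP; rewrite eq_le le// andbT.
rewrite -{2}(neg_negK U); apply: le.
exact: (open_sg neg_continuous oU).
Qed.

(** Inversion permutes the open sets, which determine the measure of Borel sets. *)
Lemma measure_neg (A : set (borel G)) : measurable A -> m (-%R @^-1` A) = m A.
Proof.
have le V : measurable (V : set (borel G)) -> (m (-%R @^-1` V) <= m V)%E.
  move=> mV; rewrite [leRHS](haar_outer hm mV).
  apply: le_ereal_inf_tmp => _ [U [oU VU] <-].
  rewrite -(measure_neg_open oU); apply: le_measure; [apply: mem_set|apply: mem_set|].
  - exact: (neg_measurable mV).
  - exact: (neg_measurable (open_borel oU)).
  - by move=> x /VU.
move=> mA; apply/eqP; rewrite eq_le le//=.
rewrite -{1}(neg_negK A); apply: le; exact: neg_measurable.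
Qed.

End Inversion.

(** * Essentially bounded functions and measure-preserving maps *)

Section EssBounded.
Context d (T : measurableType d) (R : realType).
Variable mu : {measure set T -> \bar R}.

Lemma ae_imp (P Q : T -> Prop) : (forall x, P x -> Q x) ->
  {ae mu, forall x, P x} -> {ae mu, forall x, Q x}.
Proof. by move=> PQ; apply: filterS. Qed.

Lemma ae_imp2 (P P' Q : T -> Prop) : (forall x, P x -> P' x -> Q x) ->
  {ae mu, forall x, P x} -> {ae mu, forall x, P' x} -> {ae mu, forall x, Q x}.
Proof. by move=> PQ; apply: filterS2. Qed.

Definition ess_bounded (g : T -> R) (M : R) : Prop :=
  measurable_fun setT g /\ {ae mu, forall x, `|g x| <= M}.

Lemma ess_bounded_integrable (g : T -> R) (M : R) (D : set T) :
  ess_bounded g M -> measurable D -> (mu D < +oo)%E -> mu.-integrable D (EFin \o g).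
Proof.
move=> [mg gM] mD Dfin; apply/integrableP; split.
  exact/measurable_EFinP/measurable_funTS.
apply: (@le_lt_trans _ _ (\int[mu]_(x in D) (cst `|M|%:E) x)%E).
  apply: ae_ge0_le_integral => //.
  - apply: measurableT_comp => //; exact/measurable_EFinP/measurable_funTS.
  - by move=> x _; rewrite lee_fin.
  - by apply: filterS gM => x gx _ /=; rewrite lee_fin (le_trans gx)// ler_norm.
by rewrite integral_cst// lte_mul_pinfty// lee_fin.
Qed.

Lemma ess_bounded_mul_integrable (f g : T -> R) (M : R) :
  mu.-integrable setT (EFin \o f) -> ess_bounded g M ->
  mu.-integrable setT (EFin \o (fun x => f x * g x)).
Proof.
move=> fi [mg gM]; have mf : measurable_fun setT f.
  exact/measurable_EFinP/(measurable_int mu).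
have /integrableP[_ fMfin] := integrableZl measurableT `|M| fi.
apply/integrableP; split; first exact/measurable_EFinP/measurable_funM.
apply: le_lt_trans fMfin; apply: ae_ge0_le_integral => //.
- apply: measurableT_comp => //; exact/measurable_EFinP/measurable_funM.
- apply: measurableT_comp => //; apply: measurable_funeM; exact/measurable_EFinP.
- apply: filterS gM => x gx _ /=; rewrite lee_fin !normrM normr_id mulrC.
  by rewrite ler_wpM2r// (le_trans gx)// ler_norm.
Qed.

(** The difference [g - f] is almost everywhere equal to its positive part,
    so its integral is nonnegative. *)
Lemma ae_le_Rintegral (D : set T) (f g : T -> R) : measurable D ->
  mu.-integrable D (EFin \o f) -> mu.-integrable D (EFin \o g) ->
  {ae mu, forall x, f x <= g x} -> \int[mu]_(x in D) f x <= \int[mu]_(x in D) g x.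
Proof.
move=> mD fi gi fg; rewrite -subr_ge0 -RintegralB//.
have mh : measurable_fun D (fun x => g x - f x).
  by apply: measurable_funB; [move: gi|move: fi] => /measurable_int/measurable_EFinP.
rewrite /Rintegral (ae_eq_integral (fun x => (Num.max (g x - f x) 0)%:E))//.
- by apply: fine_ge0; apply: integral_ge0 => x _; rewrite lee_fin le_max lexx orbT.
- exact/measurable_EFinP.
- by apply/measurable_EFinP/measurable_maxr => //; exact: measurable_cst.
- by apply: filterS fg => x fgx _; rewrite max_l// subr_ge0.
Qed.

Lemma ess_bounded_norm (g : T -> R) (M : R) :
  ess_bounded g M -> ess_bounded (fun x => `|g x|) M.
Proof.
move=> [mg gM]; split; first exact: measurableT_comp.
by apply: filterS gM => x; rewrite normr_id.
Qed.

Lemma integrable_cst (D : set T) (M : R) : measurable D -> (mu D < +oo)%E ->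
  mu.-integrable D (EFin \o (fun=> M)).
Proof.
move=> mD Dfin; apply: (@ess_bounded_integrable _ `|M|) => //; split.
  exact: measurable_cst.
by apply: aeW => x.
Qed.

Lemma ess_bounded_Rintegral_le (g : T -> R) (M : R) (D : set T) :
  ess_bounded g M -> measurable D -> (mu D < +oo)%E ->
  `|\int[mu]_(x in D) g x| <= M * fine (mu D).
Proof.
move=> gM mD Dfin.
have gi := ess_bounded_integrable gM mD Dfin.
apply: (le_trans (le_normr_Rintegral mD gi)).
rewrite -Rintegral_cst//; apply: ae_le_Rintegral => //.
- exact: (ess_bounded_integrable (ess_bounded_norm gM)).
- exact: integrable_cst.
- exact: gM.2.
Qed.

Lemma ae_eq_Rintegral (D : set T) (f g : T -> R) : measurable D ->
  measurable_fun D f -> measurable_fun D g ->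
  {ae mu, forall x, f x = g x} -> \int[mu]_(x in D) f x = \int[mu]_(x in D) g x.
Proof.
move=> mD mf mg fg; rewrite /Rintegral; congr fine; apply: ae_eq_integral => //.
- exact/measurable_EFinP.
- exact/measurable_EFinP.
- by apply: filterS fg => x -> _.
Qed.

Lemma ess_boundedD (g h : T -> R) (M N : R) : ess_bounded g M -> ess_bounded h N ->
  ess_bounded (fun x => g x + h x) (M + N).
Proof.
move=> [mg gM] [mh hN]; split; first exact: measurable_funD.
by apply: filterS2 gM hN => x gx hx; rewrite (le_trans (ler_normD _ _))// lerD.
Qed.

Lemma ess_boundedZ (g : T -> R) (M c : R) : ess_bounded g M ->
  ess_bounded (fun x => c * g x) (`|c| * M).
Proof.
move=> [mg gM]; split; first by apply: measurable_funM => //; exact: measurable_cst.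
by apply: filterS gM => x gx; rewrite normrM ler_wpM2l.
Qed.

Lemma ess_bounded_ge0 (g : T -> R) (M : R) : (0 < mu setT)%E -> ess_bounded g M -> 0 <= M.
Proof.
move=> m0 [_ gM]; have [x gx] : exists x, `|g x| <= M.
  by apply: (@filter_ex _ _ (ae_properfilter_algebraOfSetsType m0)) gM.
exact: le_trans gx.
Qed.

Definition preserving (phi : T -> T) : Prop :=
  measurable_fun setT phi /\ forall A, measurable A -> mu (phi @^-1` A) = mu A.

Lemma preserving_ae (phi : T -> T) (P : T -> Prop) : preserving phi ->
  {ae mu, forall x, P x} -> {ae mu, forall x, P (phi x)}.
Proof.
move=> [mphi H] [N [mN N0 PN]]; exists (phi @^-1` N); split.
- by rewrite -[X in measurable X]setTI; exact: mphi.
- by rewrite H.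
- by move=> x Px; exact: PN.
Qed.

Lemma ess_bounded_comp (phi : T -> T) (g : T -> R) (M : R) : preserving phi ->
  ess_bounded g M -> ess_bounded (g \o phi) M.
Proof.
move=> Hphi [mg gM]; split; first by apply: measurableT_comp => //; case: Hphi.
exact: preserving_ae gM.
Qed.

Lemma preserving_ge0_integral (phi : T -> T) (D : set T) (f : T -> \bar R) :
  preserving phi -> measurable D -> measurable_fun D f -> (forall y, 0 <= f y)%E ->
  (\int[mu]_(x in phi @^-1` D) f (phi x) = \int[mu]_(y in D) f y)%E.
Proof.
move=> [mphi H] mD mf f0.
rewrite -(ge0_integral_pushforward mphi)//.
by apply: eq_measure_integral => A mA _; exact: H.
Qed.

Lemma preserving_integral (phi : T -> T) (D : set T) (f : T -> \bar R) :
  preserving phi -> measurable D -> measurable_fun D f ->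
  (\int[mu]_(x in phi @^-1` D) f (phi x) = \int[mu]_(y in D) f y)%E.
Proof.
move=> Hphi mD mf; rewrite integralE [in RHS]integralE; congr (_ - _)%E.
- rewrite -(preserving_ge0_integral Hphi mD (measurable_funepos mf))//.
  by apply: eq_integral => x _; rewrite ?funeposE ?funenegE.

- rewrite -(preserving_ge0_integral Hphi mD (measurable_funeneg mf))//.
  by apply: eq_integral => x _; rewrite ?funeposE ?funenegE.

Qed.

Lemma preserving_Rintegral (phi : T -> T) (D : set T) (f : T -> R) :
  preserving phi -> measurable D -> measurable_fun D f ->
  \int[mu]_(x in phi @^-1` D) f (phi x) = \int[mu]_(y in D) f y.
Proof.
move=> Hphi mD mf; rewrite /Rintegral; congr fine.
by apply: (preserving_integral Hphi mD); exact/measurable_EFinP.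
Qed.

Lemma preserving_comp (phi psi : T -> T) : preserving phi -> preserving psi ->
  preserving (phi \o psi).
Proof.
move=> [m1 H1] [m2 H2]; split; first exact: measurableT_comp.
move=> A mA; rewrite comp_preimage H2 ?H1//.
by rewrite -[X in measurable X]setTI; exact: m1.
Qed.

(** The sets [[set t | k.+1%:R^-1 <= f t <= k%:R]] exhaust the support of [f],
    have finite measure, and [f] is bounded by [k] on each of them. *)
Lemma integrable_finite_support (f : T -> R) (e : R) :
  mu.-integrable setT (EFin \o f) -> (forall t, 0 <= f t) -> 0 < e ->
  exists (D : set T) (N : R), [/\ measurable D, (mu D < +oo)%E, 0 < N &
    forall B, measurable B -> B `<=` D ->
      \int[mu]_(t in ~` B) f t <= e + N * fine (mu (D `\` B)) ].
Proof.
move=> fi f0 e0.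
have mf : measurable_fun setT f by exact/measurable_EFinP/(measurable_int mu).
have mfE : measurable_fun setT (EFin \o f) by exact/measurable_EFinP.
pose F (k : nat) := [set t | k.+1%:R^-1 <= f t] `&` [set t | f t <= k%:R].
have mF k : measurable (F k).
  apply: measurableI.
  - rewrite -[X in measurable X]setTI [X in _ `&` X](_ : _ = f @^-1` `[k.+1%:R^-1, +oo[).
      by apply: mf => //; exact: measurable_itv.
    by apply/seteqP; split => t /=; rewrite in_itv/= andbT.
  - rewrite -[X in measurable X]setTI [X in _ `&` X](_ : _ = f @^-1` `]-oo, k%:R]).
      by apply: mf => //; exact: measurable_itv.
    by apply/seteqP; split => t /=; rewrite in_itv.
have ndF : nondecreasing_seq F.
  move=> a b ab; apply/subsetPset => t [h1 h2]; split => /=.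
    by rewrite (le_trans _ h1)// lef_pV2 ?posrE// ler_nat.
  by rewrite (le_trans h2)// ler_nat.
have := ge0_nondecreasing_set_cvg_integral (mu := mu) (f := EFin \o f) ndF mF
  (fun i => measurable_funTS mfE) (fun i x _ => f0 x).
have -> : (\int[mu]_(x in \bigcup_i F i) (EFin \o f) x = \int[mu]_x (f x)%:E)%E.
  rewrite integral_mkcond; apply: eq_integral => t _; rewrite patchE.
  case: ifPn => //; rewrite notin_setE => nF; congr EFin; apply/esym/eqP.
  rewrite eq_le f0 andbT leNgt; apply/negP => ft0; apply: nF.
  have h1 := archi_boundP (ltW ft0).
  have ft1 : 0 < (f t)^-1 by rewrite invr_gt0.
  have h2 := archi_boundP (ltW ft1).
  (* This index [k] satisfies both [f t <= k] and [1 / f t <= k.+1]. *)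
  exists (Num.bound (f t) + Num.bound (f t)^-1)%N => //; split => /=.
    rewrite -[leRHS]invrK lef_pV2 ?posrE//.
    by rewrite (le_trans (ltW h2))// ler_nat leqW// leq_addl.
  by rewrite (le_trans (ltW h1))// ler_nat leq_addr.
have Ifin : (\int[mu]_x (f x)%:E)%E \is a fin_num by exact: integrable_fin_num.
rewrite -(fineK Ifin) => /fine_cvgP [_ /cvgrPdist_lt /(_ e e0) [k _ /(_ k (leqnn k)) /= H]].
have iS (B : set T) : measurable B -> mu.-integrable B (EFin \o f).
  by move=> mB; exact: (integrableS measurableT mB (@subsetT _ B) fi).
have Fkfin : (mu (F k) < +oo)%E.
  have : (k.+1%:R^-1%:E * mu (F k) <= \int[mu]_t (f t)%:E)%E.
    rewrite -integral_cst//; apply: (@le_trans _ _ (\int[mu]_(t in F k) (f t)%:E)%E).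
      apply: ge0_le_integral => //.
      - by move=> x _ /=; rewrite lee_fin invr_ge0.
      - exact: (measurable_funTS mfE).
      - by move=> x [h _]; rewrite lee_fin.
    by apply: ge0_subset_integral => // x _; rewrite lee_fin.
  move=> h; have : (k.+1%:R^-1%:E * mu (F k) < +oo)%E.
    by apply: le_lt_trans h _; rewrite ltey_eq Ifin.
  by rewrite !ltey; apply: contra_neq => ->; rewrite gt0_muley// lte_fin.
exists (F k), k.+1%:R; split => // B mB BF.
have mC : measurable (~` B) by exact: measurableC.
have mD : measurable (F k `\` B) by exact: measurableD.
have e1 : \int[mu]_t f t = \int[mu]_(t in B) f t + \int[mu]_(t in ~` B) f t.
  rewrite -Rintegral_setU ?setUv//.
  by rewrite disj_set2E setICr.
have e2 : \int[mu]_(t in F k) f t = \int[mu]_(t in B) f t + \int[mu]_(t in F k `\` B) f t.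
  rewrite -Rintegral_setU// ?setDUK//; first exact: iS.
  by rewrite disj_set2E setDIK.
have Dfin : (mu (F k `\` B) < +oo)%E.
  by apply: le_lt_trans Fkfin; apply: le_measure; [exact: mem_set|exact: mem_set|exact: subDsetl].
have e3 : \int[mu]_(t in F k `\` B) f t <= k.+1%:R * fine (mu (F k `\` B)).
  rewrite -Rintegral_cst//; apply: le_Rintegral => //; first exact: iS.
    exact: integrable_cst.
  by move=> x [[_ h] _]; rewrite (le_trans h)// ler_nat.
have e4 : \int[mu]_t f t - \int[mu]_(t in F k) f t < e by exact: le_lt_trans (ler_norm _) H.
lra.
Qed.

End EssBounded.

(** * Averages and convolutions *)

Section Averages.
Variables (R : realType) (G : topologicalZmodType).
Hypothesis hG : hausdorff_space G.
Variable m : {measure set (borel G) -> \bar R}.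
Hypothesis hm : haar_measure m.

Definition shift (s : G) : borel G -> borel G := fun x : G => x + s.
Definition reflect (s : G) : borel G -> borel G := fun x : G => s - x.

Lemma shift_preserving (s : G) : preserving m (shift s).
Proof.
split; first exact: (continuous_borel (@continuous_addr G s)).
move=> A mA; rewrite -[RHS](measure_translate hm (- s) mA) translate_preimage opprK.
by [].
Qed.

Lemma neg_preserving : preserving m (-%R : borel G -> borel G).
Proof.
split; first exact: (continuous_borel (@neg_continuous G)).
by move=> A mA; exact: measure_neg.
Qed.

Lemma reflect_preserving (s : G) : preserving m (reflect s).
Proof.
rewrite (_ : reflect s = shift s \o (-%R : borel G -> borel G)).
  exact: (preserving_comp (shift_preserving s) neg_preserving).
by apply/funext => x; rewrite /reflect /shift /= addrC.
Qed.

Local Notation bounded_by g M := (@ess_bounded _ (borel G) R m g M).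
Local Notation rmeas f := (@measurable_fun _ _ (borel G) R setT f).

Definition avg (K : set G) (g : G -> R) (s : G) : R :=
  (fine (m K))^-1 * \int[m]_(x in K) g (x + s).

Definition rconv (f g : G -> R) (x : G) : R :=
  \int[m]_(t in setT) (f t * g (x - t)).

Lemma bounded_shift (g : G -> R) (M : R) (s : G) :
  bounded_by g M -> bounded_by (fun x : G => g (x + s)) M.
Proof. exact: (ess_bounded_comp (shift_preserving s)). Qed.

Lemma bounded_reflect (g : G -> R) (M : R) (s : G) :
  bounded_by g M -> bounded_by (fun t : G => g (s - t)) M.
Proof. exact: (ess_bounded_comp (reflect_preserving s)). Qed.

Lemma bounded_pos (g : G -> R) (M : R) :
  bounded_by g M -> bounded_by (fun x => Num.max (g x) 0) M.
Proof.
move=> [mg gM]; split; first by apply: measurable_maxr => //; exact: measurable_cst.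
apply: filterS gM => x gx; rewrite ger0_norm; last by rewrite le_max lexx orbT.
by rewrite ge_max (le_trans (ler_norm _) gx) (le_trans (normr_ge0 _) gx).
Qed.

Lemma bounded_neg (g : G -> R) (M : R) :
  bounded_by g M -> bounded_by (fun x => Num.max (- g x) 0) M.
Proof.
move=> [mg gM]; apply: (bounded_pos (g := fun x => - g x)); split.
  exact: measurable_funN.
by apply: filterS gM => x; rewrite normrN.
Qed.

Lemma max_posneg (y : R) : Num.max y 0 - Num.max (- y) 0 = y.
Proof.
have [y0|y0] := leP 0 y.
  by rewrite max_r ?subr0// oppr_le0.
by rewrite max_l ?oppr_ge0 ?(ltW y0)// opprK add0r.
Qed.

Lemma max0_ge0 (y : R) : 0 <= Num.max y 0.
Proof. by rewrite le_max lexx orbT. Qed.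

Section FixedSet.
Variable K : set G.
Hypothesis mK : measurable (K : set (borel G)).
Hypothesis Kfin : (m K < +oo)%E.

Lemma integrable_shift (g : G -> R) (M : R) (s : G) : bounded_by g M ->
  m.-integrable (K : set (borel G)) (EFin \o (fun x : G => g (x + s))).
Proof. by move=> /(bounded_shift s) gM; exact: (ess_bounded_integrable gM). Qed.

(** Measurability in [s] of the integral of [\1_K t * g (s + t)] over [t] is part
    of what [swappable_mul] provides for [g >= 0]. *)
Lemma measurable_shift_integral (g : G -> R) (M : R) : bounded_by g M ->
  rmeas (fun s => \int[m]_(x in K) g (x + s)).
Proof.
have pos h N : bounded_by h N -> (forall x, 0 <= h x) ->
    rmeas (fun s => \int[m]_(x in K) h (x + s)).
  move=> hN h0.
  have K1fin : (\int[m]_t (\1_K t)%:E < +oo)%E by rewrite integral_indic// setIT.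
  have K0 (t : G) : 0 <= \1_K t :> R by rewrite indicE.
  have S := swappable_mul hG hm (@id_continuous G) (fun _ _ => erefl) (fun _ => erefl)
    mK Kfin (measurable_indic mK) K0 K1fin hN.1 h0.
  have := swap_int1 S => /(measurableT_comp (@fine_measurable R setT measurableT)).
  rewrite [X in measurable_fun _ X -> _](_ : _ = (fun s => \int[m]_(x in K) h (x + s)))//.
  apply/funext => s /=; rewrite /Rintegral; congr fine.
  rewrite [RHS]integral_mkcond; apply: eq_integral => t _.
  by rewrite patchE indicE; case: ifPn; rewrite ?mul1r ?mul0r// addrC.
move=> gM.
rewrite (_ : (fun s => _) = (fun s =>
  \int[m]_(x in K) Num.max (g (x + s)) 0 - \int[m]_(x in K) Num.max (- g (x + s)) 0)).
  apply: measurable_funB.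
  - exact: (pos _ _ (bounded_pos gM) (fun x => max0_ge0 _)).
  - exact: (pos _ _ (bounded_neg gM) (fun x => max0_ge0 _)).
apply/funext => s; rewrite -RintegralB//.
- by apply: eq_Rintegral => x _; rewrite max_posneg.
- exact: (integrable_shift s (bounded_pos gM)).
- exact: (integrable_shift s (bounded_neg gM)).
Qed.

Lemma shift_integral_bounded (g : G -> R) (M : R) : bounded_by g M ->
  bounded_by (fun s => \int[m]_(x in K) g (x + s)) (M * fine (m K)).
Proof.
move=> gM; split; first exact: measurable_shift_integral gM.
by apply: aeW => s; exact: (ess_bounded_Rintegral_le (bounded_shift s gM)).
Qed.

(** Tonelli for [f t * g (x - t + s0)] on [K * G].  All inner integrals are
    finite, which allows one to pass between extended and real values. *)
Lemma rconv_swap_ge0 (f g : G -> R) (M : R) (s0 : G) :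
  m.-integrable (setT : set (borel G)) (EFin \o f) -> (forall t, 0 <= f t) ->
  bounded_by g M -> (forall x, 0 <= g x) ->
  [/\ rmeas (fun x => rconv f g (x + s0)),
      m.-integrable (K : set (borel G)) (EFin \o (fun x => rconv f g (x + s0))) &
      \int[m]_(x in K) rconv f g (x + s0) =
      \int[m]_(t in setT) (f t * \int[m]_(x in K) g (x + (s0 - t)))].
Proof.
move=> fi f0 gM g0.
have gsM := bounded_shift s0 gM.
have mf : rmeas f by have /measurable_int/measurable_EFinP := fi.
have ffin : (\int[m]_t (f t)%:E < +oo)%E.
  by rewrite ltey_eq; apply/orP; left; exact: integrable_fin_num.
have S := swappable_mul hG hm (@neg_continuous G) (@opprD G) (@opprK G)
    mK Kfin mf f0 ffin gsM.1 (fun x => g0 _).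
have inE1 (x : G) : (\int[m]_t (f t * g (x - t + s0))%:E =
    (rconv f g (x + s0))%:E)%E.
  rewrite /rconv /Rintegral fineK.
    by apply: eq_integral => t _; rewrite addrAC.
  apply: integrable_fin_num => //.
  exact: (ess_bounded_mul_integrable fi (bounded_reflect (x + s0) gM)).
have inE2 (t : G) : (\int[m]_(x in K) (f t * g (x - t + s0))%:E =
    (f t * \int[m]_(x in K) g (x + (s0 - t)))%:E)%E.
  rewrite -RintegralZl//; last exact: integrable_shift gM.
  rewrite /Rintegral fineK.
    by apply: eq_integral => x _; rewrite addrAC addrA.
  apply: integrable_fin_num => //.
  have := integrableZl mK (f t) (integrable_shift (s0 - t) gM).
  by apply: eq_integrable.
have mr : rmeas (fun x => rconv f g (x + s0)).
  apply/measurable_EFinP; apply: eq_measurable_fun (swap_int1 S) => x _.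
  exact: inE1.
have eqs := swap_eq S.
have e1 : (\int[m]_(x in K) \int[m]_t (f t * g (x - t + s0))%:E =
    \int[m]_(x in K) (rconv f g (x + s0))%:E)%E.
  by apply: eq_integral => x _; exact: inE1.
have e2 : (\int[m]_t \int[m]_(x in K) (f t * g (x - t + s0))%:E =
    \int[m]_t (f t * \int[m]_(x in K) g (x + (s0 - t)))%:E)%E.
  by apply: eq_integral => t _; exact: inE2.
have e3 : (\int[m]_(x in K) (rconv f g (x + s0))%:E =
    \int[m]_t (f t * \int[m]_(x in K) g (x + (s0 - t)))%:E)%E.
  by rewrite -e1 -e2; exact: eqs.
split => //; last by rewrite /Rintegral e3.
apply/integrableP; split; first exact/measurable_EFinP/measurable_funTS.
rewrite (_ : \int[m]_(x in K) _ = \int[m]_(x in K) (rconv f g (x + s0))%:E)%E; last first.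
  apply: eq_integral => x _; rewrite /= ger0_norm//.
  by apply: Rintegral_ge0 => t _; rewrite mulr_ge0.
rewrite e3 ltey_eq; apply/orP; left; apply: integrable_fin_num => //.
apply: (ess_bounded_mul_integrable fi).
exact: (bounded_reflect s0 (shift_integral_bounded gM)).
Qed.

Lemma rconv_swap (f g : G -> R) (M : R) (s0 : G) :
  m.-integrable (setT : set (borel G)) (EFin \o f) -> (forall t, 0 <= f t) ->
  bounded_by g M ->
  \int[m]_(x in K) rconv f g (x + s0) =
  \int[m]_(t in setT) (f t * \int[m]_(x in K) g (x + (s0 - t))).
Proof.
move=> fi f0 gM.
have gp := bounded_pos gM; have gn := bounded_neg gM.
have [_ ip ep] := rconv_swap_ge0 s0 fi f0 gp (fun x => max0_ge0 _).
have [_ i_n en] := rconv_swap_ge0 s0 fi f0 gn (fun x => max0_ge0 _).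
have e1 x : rconv f g x = rconv f (fun x => Num.max (g x) 0) x -
                          rconv f (fun x => Num.max (- g x) 0) x.
  rewrite /rconv -RintegralB//.
  - by apply: eq_Rintegral => t _; rewrite -mulrBr max_posneg.
  - exact: (ess_bounded_mul_integrable fi (bounded_reflect x gp)).
  - exact: (ess_bounded_mul_integrable fi (bounded_reflect x gn)).
transitivity (\int[m]_(x in K) (rconv f (fun x => Num.max (g x) 0) (x + s0) -
                          rconv f (fun x => Num.max (- g x) 0) (x + s0))).
  by apply: eq_Rintegral => x _; rewrite e1.
rewrite RintegralB// ep en -RintegralB//.
- apply: eq_Rintegral => t _; rewrite -mulrBr; congr (_ * _).
  rewrite -RintegralB//.
  + by apply: eq_Rintegral => x _; rewrite max_posneg.
  + exact: integrable_shift gp.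
  + exact: integrable_shift gn.
- apply: (ess_bounded_mul_integrable fi).
  exact: (bounded_reflect s0 (shift_integral_bounded gp)).
- apply: (ess_bounded_mul_integrable fi).
  exact: (bounded_reflect s0 (shift_integral_bounded gn)).
Qed.

(** Up to the change of variable [x -> x - t], the two integrals have the same
    integrand, over sets which differ by [K `+` translate (- t) K]. *)
Lemma shift_integral_foelner (g : G -> R) (M : R) (s t : G) : bounded_by g M ->
  `|\int[m]_(x in K) g (x + (s - t)) - \int[m]_(x in K) g (x + s)| <=
  M * fine (m (K `+` translate (- t) K)).
Proof.
move=> gM; have hM := bounded_shift s gM; set h := fun x : G => g (x + s) in hM.
pose D := translate (- t) K.
have mD : measurable (D : set (borel G)) by exact: measurable_translate.
have Dfin : (m D < +oo)%E by rewrite [ltLHS](measure_translate hm).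
have -> : \int[m]_(x in K) g (x + (s - t)) = \int[m]_(x in D) h x.
  rewrite -(preserving_Rintegral (shift_preserving (- t)) mD); last first.
    exact: measurable_funTS hM.1.
  rewrite (_ : shift (- t) @^-1` D = K).
    by apply: eq_Rintegral => x _; rewrite /h /shift /= -addrA [- t + s]addrC.
  rewrite /D translate_preimage opprK; apply/seteqP; split => x;
    by rewrite /shift /= -addrA addNr addr0.
have ih (B : set (borel G)) : measurable B -> (m B < +oo)%E ->
   m.-integrable B (EFin \o h) by move=> mB; exact: (ess_bounded_integrable hM).
have mI : measurable (K `&` D : set (borel G)) by exact: measurableI.
have mI' : measurable (D `&` K : set (borel G)) by exact: measurableI.
have mDK : measurable (D `\` K : set (borel G)) by exact: measurableD.
have mKD : measurable (K `\` D : set (borel G)) by exact: measurableD.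
have DKfin : (m (D `\` K) < +oo)%E.
  by apply: le_lt_trans Dfin; apply: le_measure; [exact: mem_set|exact: mem_set|exact: subDsetl].
have KDfin : (m (K `\` D) < +oo)%E.
  by apply: le_lt_trans Kfin; apply: le_measure; [exact: mem_set|exact: mem_set|exact: subDsetl].
have eK : \int[m]_(x in K) h x = \int[m]_(x in K `&` D) h x + \int[m]_(x in K `\` D) h x.
  rewrite -Rintegral_setU ?setUIDK//; first exact: ih.
  by rewrite disj_set2E; apply/eqP; rewrite setDE setIACA setICr setI0.
have eD : \int[m]_(x in D) h x = \int[m]_(x in D `&` K) h x + \int[m]_(x in D `\` K) h x.
  rewrite -Rintegral_setU ?setUIDK//; first exact: ih.
  by rewrite disj_set2E; apply/eqP; rewrite setDE setIACA setICr setI0.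
have bK := ess_bounded_Rintegral_le hM mKD KDfin.
have bD := ess_bounded_Rintegral_le hM mDK DKfin.
(* The integrals over [K `&` D] cancel; each part of the symmetric
   difference contributes at most [M] times its measure. *)
have -> : fine (m (K `+` D)) = fine (m (K `\` D)) + fine (m (D `\` K)).
  rewrite /setY measureU//; first by rewrite fineD// ge0_fin_numE.
  by apply/seteqP; split => // x [[Kx _] [_ nKx]].
have -> : \int[m]_(x in K) g (x + s) = \int[m]_(x in K) h x by [].
rewrite eK eD [D `&` K]setIC opprD addrACA subrr add0r.
rewrite (le_trans (ler_normB _ _))// mulrDr addrC lerD//.
Qed.

End FixedSet.
End Averages.

(** * Convolution hardly changes averages, and averages are convolutions *)

Section Invariance.
Variables (R : realType) (G : topologicalZmodType).
Hypothesis hG : hausdorff_space G.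
Variable m : {measure set (borel G) -> \bar R}.
Hypothesis hm : haar_measure m.
Local Notation bounded_by g M := (@ess_bounded _ (borel G) R m g M).
Local Notation rmeas f := (@measurable_fun _ _ (borel G) R setT f).
Local Notation integrable f :=
  (m.-integrable (setT : set (borel G)) (EFin \o (f : borel G -> R))).

Section FixedSet.
Variable K : set G.
Hypothesis mK : measurable (K : set (borel G)).
Hypothesis Kfin : (m K < +oo)%E.
Hypothesis K0 : (0 < m K)%E.
Let k := fine (m K).

Lemma fine_measure_gt0 : 0 < k.
Proof. by rewrite fine_gt0// K0 Kfin. Qed.

(** By the exchange of integrals the left-hand side is
    [\int f(t) (avg (s - t) - avg s) dm(t)].  The bracket is at most [M * eta] on
    [B] and at most [2 * M] elsewhere. *)
Lemma avg_rconv_le (f g : G -> R) (M eta : R) (B : set G) (s : G) :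
  integrable f -> (forall t, 0 <= f t) -> \int[m]_(t in setT) f t = 1 ->
  bounded_by g M -> 0 <= M -> measurable (B : set (borel G)) -> 0 <= eta ->
  (forall t, B t -> fine (m (K `+` translate (- t) K)) <= eta * k) ->
  `|avg m K (rconv m f g) s - avg m K g s| <=
    M * eta + 2 * M * \int[m]_(t in ~` B) f t.
Proof.
move=> fi f0 f1 gM M0 mB eta0 HB.
have k0 := fine_measure_gt0.
pose c := \int[m]_(x in K) g (x + s).
pose u (t : G) := \int[m]_(x in K) g (x + (s - t)) - c.
have bint := shift_integral_bounded hG hm mK Kfin gM.
have bu : bounded_by u (2 * M * k).
  have bc : bounded_by (fun=> - c) (M * k).
    split; first exact: measurable_cst.
    apply: aeW => _; rewrite normrN.
    exact: (ess_bounded_Rintegral_le (bounded_shift hm s gM)).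
  have -> : 2 * M * k = M * k + M * k by lra.
  exact: (ess_boundedD (bounded_reflect hG hm s bint) bc).
have fu : integrable (fun t => f t * u t) by exact: (ess_bounded_mul_integrable fi bu).
have fun_ : integrable (fun t => f t * `|u t|).
  exact: (ess_bounded_mul_integrable fi (ess_bounded_norm bu)).
have mBC : measurable (~` B : set (borel G)) by exact: measurableC.
have iS (h : G -> R) (E : set (borel G)) : measurable E -> integrable h ->
    m.-integrable E (EFin \o (h : borel G -> R)).
  by move=> mE hi; exact: (integrableS measurableT mE (@subsetT _ E) hi).
have u2 t : `|u t| <= 2 * M * k.
  rewrite /u (le_trans (ler_normB _ _))// -mulrA mulr_natl mulr2n lerD//.
  - exact: (ess_bounded_Rintegral_le (bounded_shift hm (s - t) gM)).
  - exact: (ess_bounded_Rintegral_le (bounded_shift hm s gM)).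
have uB t : B t -> `|u t| <= M * (eta * k).
  move=> Bt; apply: (le_trans (shift_integral_foelner hm mK Kfin s t gM)).
  by rewrite ler_wpM2l// HB.
have -> : avg m K (rconv m f g) s - avg m K g s =
    k^-1 * \int[m]_(t in setT) (f t * u t).
  rewrite /avg -mulrBr; congr (_ * _).
  rewrite (rconv_swap hG hm mK Kfin s fi f0 gM) -/c.
  rewrite -[c in LHS]mul1r -f1 -RintegralZr// -RintegralB//.
  - by apply: eq_Rintegral => t _; rewrite -mulrBr.
  - exact: (ess_bounded_mul_integrable fi (bounded_reflect hG hm s bint)).
  - have := integrableZr measurableT c fi.
    by apply: eq_integrable.
rewrite normrM ger0_norm ?invr_ge0 ?(ltW k0)// mulrC ler_pdivrMr//.
apply: (le_trans (le_normr_Rintegral measurableT fu)).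
rewrite (_ : \int[m]_(t in setT) `|f t * u t| = \int[m]_(t in setT) (f t * `|u t|)); last first.
  by apply: eq_Rintegral => t _; rewrite normrM ger0_norm.
rewrite -(setUv B) Rintegral_setU//; last 2 first.
- by rewrite setUv.
- by rewrite disj_set2E setICr.
rewrite mulrDl; apply: lerD.
- apply: (@le_trans _ _ (\int[m]_(t in B) (M * (eta * k) * f t))).
    apply: le_Rintegral => //; [exact: iS| |].
      have := integrableZl mB (M * (eta * k)) (iS _ _ mB fi).
      by apply: eq_integrable.
    by move=> t Bt; rewrite mulrC ler_wpM2r// uB.
  rewrite RintegralZl//; last exact: iS.
  have fB1 : \int[m]_(t in B) f t <= 1.
    rewrite -f1 -(setUv B) Rintegral_setU//; last 2 first.
    - by rewrite setUv.
    - by rewrite disj_set2E setICr.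
    by rewrite lerDl; apply: Rintegral_ge0 => t _.
  rewrite mulrA ler_piMr// !mulr_ge0// ltW//.
- apply: (@le_trans _ _ (\int[m]_(t in ~` B) (2 * M * k * f t))).
    apply: le_Rintegral => //; [exact: iS| |].
      have := integrableZl mBC (2 * M * k) (iS _ _ mBC fi).
      by apply: eq_integrable.
    by move=> t _; rewrite mulrC ler_wpM2r// u2.
  by rewrite RintegralZl//; [rewrite mulrAC|exact: iS].
Qed.

(** The density of the uniform distribution on [- K]. *)
Definition kernel (t : G) : R := k^-1 * \1_K (- t).

Lemma kernel_indic (t : G) : \1_K (- t) = \1_(-%R @^-1` K) t :> R.
Proof. by rewrite !indicE. Qed.

Lemma measurable_negK : measurable (-%R @^-1` K : set (borel G)).
Proof. exact: (@neg_measurable G K mK). Qed.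

Lemma measure_negK : m (-%R @^-1` K) = m K.
Proof. exact: measure_neg. Qed.

Lemma integrable_indic_neg : integrable (fun t => \1_K (- t)).
Proof.
rewrite (_ : (fun t => _) = \1_(-%R @^-1` K)); last first.
  by apply/funext => t; exact: kernel_indic.
apply/integrableP; split; first by apply/measurable_EFinP; apply: measurable_indic; exact: measurable_negK.
rewrite (_ : (\int[m]_x _)%E = (\int[m]_x (\1_(-%R @^-1` K) x)%:E)%E); last first.
  by apply: eq_integral => x _; rewrite /= ger0_norm // indicE.
rewrite (integral_indic m measurableT measurable_negK).
by rewrite setIT measure_negK.
Qed.

Lemma kernel_integrable : integrable kernel.
Proof.
have := integrableZl measurableT k^-1 integrable_indic_neg.
by apply: eq_integrable.
Qed.

Lemma kernel_ge0 t : 0 <= kernel t.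
Proof. by rewrite mulr_ge0// ?invr_ge0 ?(ltW fine_measure_gt0)// indicE. Qed.

Lemma kernel_int1 : \int[m]_(t in setT) kernel t = 1.
Proof.
rewrite RintegralZl//; last exact: integrable_indic_neg.
rewrite (_ : \int[m]_(x in _) _ = k) ?mulVf ?gt_eqF ?fine_measure_gt0//.
rewrite /Rintegral (_ : (\int[m]_x _)%E = (\int[m]_x (\1_(-%R @^-1` K) x)%:E)%E); last first.
  by apply: eq_integral => x _; rewrite kernel_indic.
rewrite (integral_indic m measurableT measurable_negK).
by rewrite setIT measure_negK.
Qed.

(** The substitution [t -> - t], which preserves [m]. *)
Lemma rconv_kernel (g : G -> R) (M : R) (s : G) : bounded_by g M ->
  rconv m kernel g s = avg m K g s.
Proof.
move=> gM; rewrite /rconv /avg -/k.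
have gs := bounded_reflect hG hm s gM.
transitivity (\int[m]_(t in setT) (k^-1 * (\1_K (- t) * g (s - t)))).
  by apply: eq_Rintegral => t _; rewrite mulrA.
rewrite RintegralZl//; last exact: (ess_bounded_mul_integrable integrable_indic_neg gs).
congr (_ * _).
pose H (u : G) := \1_K u * g (u + s).
have mH : rmeas H.
  by apply: measurable_funM; [exact: measurable_indic|exact: (bounded_shift hm s gM).1].
transitivity (\int[m]_(u in setT) H u).
  rewrite -(preserving_Rintegral (neg_preserving hG hm) measurableT mH) preimage_setT.
  by apply: eq_Rintegral => t _; rewrite /H addrC.
rewrite [RHS]Rintegral_mkcond; apply: eq_Rintegral => t _.
by rewrite /H patchE indicE; case: ifPn; rewrite ?mul1r ?mul0r.
Qed.

End FixedSet.
End Invariance.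

(** * Complex-valued functions, and invariant means of averages *)

Section Complex.
Variables (R : realType) (G : topologicalZmodType).
Hypothesis hG : hausdorff_space G.
Variable m : {measure set (borel G) -> \bar R}.
Hypothesis hm : haar_measure m.
Local Notation bounded_by g M := (@ess_bounded _ (borel G) R m g M).
Local Notation Re := complex.Re.
Local Notation Im := complex.Im.
Local Open Scope complex_scope.

Lemma net_averageE (K : set G) (psi : G -> R[i]) (s : G) :
  net_average m K psi s =
  (avg m K (fun x => Re (psi x)) s) +i* (avg m K (fun x => Im (psi x)) s).
Proof.
rewrite /net_average /cintegral /avg.
by apply/eqP; rewrite eq_complex /= !mul0r subr0 addr0 !eqxx.
Qed.

Lemma convolutionE (f : G -> R) (psi : G -> R[i]) (x : G) :
  convolution m f psi x =
  (rconv m f (fun x => Re (psi x)) x) +i* (rconv m f (fun x => Im (psi x)) x).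
Proof.
rewrite /convolution /cintegral /rconv; congr (_ +i* _).
- by apply: eq_Rintegral => t _; case: (psi _) => a b /=; rewrite mul0r subr0.
- by apply: eq_Rintegral => t _; case: (psi _) => a b /=; rewrite mul0r addr0.
Qed.

Lemma normr_Re_cmod (z : R[i]) : `|Re z| <= cmod z.
Proof.
case: z => a b; rewrite /cmod /= -sqrtr_sqr ler_wsqrtr// lerDl sqr_ge0//.
Qed.

Lemma normr_Im_cmod (z : R[i]) : `|Im z| <= cmod z.
Proof.
case: z => a b; rewrite /cmod /= -sqrtr_sqr ler_wsqrtr// lerDr sqr_ge0//.
Qed.

Lemma cmod_le (z : R[i]) : cmod z <= `|Re z| + `|Im z|.
Proof.
case: z => a b; rewrite /cmod /= -[leRHS]ger0_norm ?addr_ge0// -sqrtr_sqr.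
rewrite ler_wsqrtr// sqrrD !real_normK ?num_real// -addrA lerD2l lerDr.
by rewrite mulrn_wge0// mulr_ge0.
Qed.

Lemma norm_complexE (z : R[i]) : `|z| = (cmod z)%:C.
Proof. by []. Qed.

Lemma haar_gt0 : (0 < m setT)%E.
Proof. by rewrite lt0e (haar_neq0 hm) measure_ge0. Qed.

Lemma Linfty_normE (psi : G -> R[i]) :
  Linfty_norm m psi = ess_sup m (fun x => (cmod (psi x))%:E).
Proof.
rewrite /Linfty_norm unlock haar_gt0; congr (ess_sup m _).
apply/funext => x /=; rewrite ger0_norm//.
by rewrite (le_trans _ (normr_Re_cmod _)).
Qed.

Lemma Linfty_norm_le (psi : G -> R[i]) (M : R) :
  {ae m, forall x, cmod (psi x) <= M} -> (Linfty_norm m psi <= M%:E)%E.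
Proof.
by move=> H; rewrite Linfty_normE; apply/ess_supP; apply: ae_imp H => x; rewrite lee_fin.
Qed.

Lemma Linfty_norm_fin (psi : G -> R[i]) :
  Linfty m psi -> Linfty_norm m psi = (fine (Linfty_norm m psi))%:E.
Proof.
by move=> [_ fin]; rewrite fineK// ge0_fin_numE//; exact: Lnorm_ge0.
Qed.

Lemma Linfty_cmod (psi : G -> R[i]) : Linfty m psi ->
  {ae m, forall x, cmod (psi x) <= fine (Linfty_norm m psi)}.
Proof.
move=> H; have := ess_sup_ge m (fun x => (cmod (psi x))%:E).
rewrite -Linfty_normE (Linfty_norm_fin H).
by apply: ae_imp => x; rewrite lee_fin.
Qed.

Lemma Linfty_bounded_Re (psi : G -> R[i]) : Linfty m psi ->
  bounded_by (fun x => Re (psi x)) (fine (Linfty_norm m psi)).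
Proof.
move=> H; split; first by case: H => -[].
by apply: ae_imp (Linfty_cmod H) => x; apply: le_trans; exact: normr_Re_cmod.
Qed.

Lemma Linfty_bounded_Im (psi : G -> R[i]) : Linfty m psi ->
  bounded_by (fun x => Im (psi x)) (fine (Linfty_norm m psi)).
Proof.
move=> H; split; first by case: H => -[].
by apply: ae_imp (Linfty_cmod H) => x; apply: le_trans; exact: normr_Im_cmod.
Qed.

Lemma bounded_Linfty (psi : G -> R[i]) (M N : R) :
  bounded_by (fun x => Re (psi x)) M -> bounded_by (fun x => Im (psi x)) N ->
  Linfty m psi.
Proof.
move=> [m1 b1] [m2 b2]; split => //.
apply: (@le_lt_trans _ _ (M + N)%:E); last by rewrite ltry.
apply: Linfty_norm_le; apply: ae_imp2 b1 b2 => x h1 h2.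
by rewrite (le_trans (cmod_le _))// lerD.
Qed.

Lemma Linfty_cst (z : R[i]) : Linfty m (fun=> z).
Proof.
apply: (@bounded_Linfty _ `|Re z| `|Im z|); split;
  by [exact: measurable_cst|exact: aeW].
Qed.

End Complex.

Section Reverse.
Variables (R : realType) (G : topologicalZmodType).
Hypothesis hG : hausdorff_space G.
Variable m : {measure set (borel G) -> \bar R}.
Hypothesis hm : haar_measure m.
Local Notation Re := complex.Re.
Local Notation Im := complex.Im.
Local Open Scope complex_scope.

Section Kernel.
Variable K : set G.
Hypothesis cK : compact K.
Hypothesis K0 : (0 < m K)%E.
Let mK : measurable (K : set (borel G)) := compact_borel hG cK.
Let Kfin : (m K < +oo)%E := haar_compact hm cK.

Lemma kernel_prob : L1_prob m (kernel m K).
Proof.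
split.
- exact: kernel_integrable.
- by apply: aeW => x; exact: kernel_ge0.
- exact: kernel_int1.
Qed.

Lemma convolution_kernel (psi : G -> R[i]) (s : G) : Linfty m psi ->
  convolution m (kernel m K) psi s = net_average m K psi s.
Proof.
move=> H; rewrite convolutionE net_averageE; congr (_ +i* _).
- exact: (rconv_kernel hG hm mK Kfin s (Linfty_bounded_Re hm H)).
- exact: (rconv_kernel hG hm mK Kfin s (Linfty_bounded_Im hm H)).
Qed.

Lemma avg_bounded (g : G -> R) (M : R) :
  @ess_bounded _ (borel G) R m g M -> @ess_bounded _ (borel G) R m (avg m K g) M.
Proof.
move=> gM; have := ess_boundedZ (fine (m K))^-1 (shift_integral_bounded hG hm mK Kfin gM).
have k0 : 0 < fine (m K) by rewrite fine_gt0// K0 Kfin.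
rewrite ger0_norm ?invr_ge0 ?(ltW k0)// mulrCA mulVf ?mulr1// gt_eqF//.
Qed.

Lemma Linfty_net_average (psi : G -> R[i]) : Linfty m psi -> Linfty m (net_average m K psi).
Proof.
move=> H; rewrite (_ : net_average m K psi = (fun s =>
  (avg m K (fun x => Re (psi x)) s) +i* (avg m K (fun x => Im (psi x)) s))); last first.
  by apply/funext => s; rewrite net_averageE.
apply: (bounded_Linfty hm).
- exact: (avg_bounded (Linfty_bounded_Re hm H)).
- exact: (avg_bounded (Linfty_bounded_Im hm H)).
Qed.

End Kernel.

(** Convolving [psi] with the density of the uniform distribution on [- K d] does
    not change the value of an invariant mean [phi] and gives a function
    uniformly close to [alpha]. Hence [phi psi] is close to
    [phi (fun=> alpha) = alpha]. *)
Lemma uniform_almost_convergent (disp : Order.disp_t) (Delta : preorderType disp)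
    (K : Delta -> set G) (hK : summing_net m K)
    (psi : G -> R[i]) (hpsi : Linfty m psi) (alpha : R[i]) :
  net_cvg_unif [set: G] (fun d s => net_average m (K d) psi s) alpha ->
  almost_convergent m psi alpha.
Proof.
move=> H phi [[[lin [M bd]] _ one] inv].
apply/eqP; rewrite -subr_eq0; apply/eqP/Normc.eq0_normc; rewrite -/(cmod _).
apply/eqP; rewrite eq_le; apply/andP; split; last exact: le_trans (normr_Re_cmod _).
have step (e : R) : 0 < e -> cmod (phi psi - alpha) <= `|M| * e.
  move=> e0.
  have eC : 0 < e%:C :> R[i] by rewrite ltcR.
  have [d0 /(_ d0 (lexx _)) Hd] := H _ eC.
  have cK : compact (K d0) by exact: (net_compact hK).
  have K0 : (0 < m (K d0))%E by exact: (net_gt0 hK).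
  have L1 := Linfty_net_average cK K0 hpsi.
  have Lc := Linfty_cst hm (1 : R[i]).
  have E1 : phi (net_average m (K d0) psi) = phi psi.
    rewrite -(inv psi (kernel m (K d0)) hpsi (kernel_prob cK K0)); congr phi.
    by apply/funext => s; rewrite convolution_kernel.
  have -> : phi psi - alpha = phi (fun x => - alpha * 1 + net_average m (K d0) psi x).
    by rewrite (lin (- alpha) _ _ Lc L1) one mulr1 E1 addrC.
  set th := fun x => _ + _.
  have thE : th = fun x => (net_average m (K d0) psi x - alpha).
    by apply/funext => x; rewrite /th mulr1 addrC.
  have the : (Linfty_norm m th <= e%:E)%E.
    apply: Linfty_norm_le => //; apply: aeW => x; rewrite thE.
    by have := ltW (Hd x I); rewrite norm_complexE lecR.
  have Lth : Linfty m th.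
    split; last by rewrite (le_lt_trans the)// ltry.
    rewrite thE; have [[m1 m2] _] := L1; split => /=.
    - under eq_fun do rewrite raddfB; apply: measurable_funB => //; exact: measurable_cst.
    - under eq_fun do rewrite raddfB; apply: measurable_funB => //; exact: measurable_cst.
  have := bd th Lth; rewrite (Linfty_norm_fin Lth) -EFinM lee_fin => /le_trans; apply.
  have n0 : 0 <= fine (Linfty_norm m th) by rewrite fine_ge0// Lnorm_ge0.
  apply: (@le_trans _ _ (`|M| * fine (Linfty_norm m th))).
    by rewrite ler_wpM2r// ler_norm.
  by rewrite ler_wpM2l// -lee_fin -(Linfty_norm_fin Lth).
apply/ler_addgt0Pr => e e0; rewrite add0r.
have M1 : 0 < `|M| + 1 by rewrite ltr_wpDl.
apply: le_trans (step (e / (`|M| + 1)) _) _; first by rewrite divr_gt0.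
rewrite mulrCA ler_piMr ?(ltW e0)// ler_pdivrMr// mul1r lerDl//.
Qed.

End Reverse.

(** * Limits of averages along an ultrafilter *)

Lemma fmap_ultra (T T' : Type) (h : T -> T') (U : set_system T) :
  UltraFilter U -> UltraFilter (h @ U).
Proof.
move=> UU; split=> [|F PF sUF]; first exact: fmap_proper_filter.
apply/seteqP; split=> A; last exact: sUF.
move=> FA; have [//|UnA] := in_ultra_setVsetC (h @^-1` A) UU.
have FnA : F (~` A) by exact: sUF.
by have [x []] := filter_ex (filterI FA FnA).
Qed.

Section UltraMean.
Variables (R : realType) (G : topologicalZmodType).
Hypothesis hG : hausdorff_space G.
Variable m : {measure set (borel G) -> \bar R}.
Hypothesis hm : haar_measure m.
Local Notation bounded_by g M := (@ess_bounded _ (borel G) R m g M).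
Local Notation integrable f :=
  (m.-integrable (setT : set (borel G)) (EFin \o (f : borel G -> R))).

Section Avg.
Variable K : set G.
Hypothesis mK : measurable (K : set (borel G)).
Hypothesis Kfin : (m K < +oo)%E.
Hypothesis K0 : (0 < m K)%E.

Lemma avgD (g h : G -> R) (M N : R) (s : G) : bounded_by g M -> bounded_by h N ->
  avg m K (fun x => g x + h x) s = avg m K g s + avg m K h s.
Proof.
move=> gM hN; rewrite /avg -mulrDr -RintegralD//.
- exact: integrable_shift gM.
- exact: integrable_shift hN.
Qed.

Lemma avgZ (c : R) (g : G -> R) (M : R) (s : G) : bounded_by g M ->
  avg m K (fun x => c * g x) s = c * avg m K g s.
Proof.
move=> gM; rewrite /avg mulrCA RintegralZl//.
exact: integrable_shift gM.
Qed.

Lemma avg_le (g : G -> R) (M : R) (s : G) : bounded_by g M -> `|avg m K g s| <= M.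
Proof.
move=> gM; have k0 := fine_measure_gt0 Kfin K0.
rewrite /avg normrM ger0_norm ?invr_ge0 ?(ltW k0)// mulrC ler_pdivrMr//.
exact: (ess_bounded_Rintegral_le (bounded_shift hm s gM)).
Qed.

Lemma avg_ge0 (g : G -> R) (M : R) (s : G) : bounded_by g M ->
  {ae m, forall x, 0 <= g x} -> 0 <= avg m K g s.
Proof.
move=> gM g0; have k0 := fine_measure_gt0 Kfin K0.
rewrite /avg mulr_ge0 ?invr_ge0 ?(ltW k0)//.
rewrite -(mul0r (fine (m K))) -Rintegral_cst//.
apply: ae_le_Rintegral => //.
- exact: integrable_cst.
- exact: integrable_shift gM.
- exact: (preserving_ae (shift_preserving hm s) g0).
Qed.

Lemma avg_cst (c : R) (s : G) : avg m K (fun=> c) s = c.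
Proof.
have k0 := fine_measure_gt0 Kfin K0.
by rewrite /avg Rintegral_cst// mulrCA mulVf ?mulr1// gt_eqF.
Qed.

End Avg.

(** A density is only nonnegative almost everywhere, but convolution depends only
    on its almost everywhere class. *)
Lemma rconv_nonneg (f g : G -> R) (M : R) : L1_prob m f -> bounded_by g M ->
  exists f' : G -> R, [/\ integrable f', forall t, 0 <= f' t,
    \int[m]_(t in setT) f' t = 1 & rconv m f g = rconv m f' g].
Proof.
move=> [fi f0 f1] gM.
have mf : measurable_fun (setT : set (borel G)) (f : borel G -> R).
  by have /measurable_int/measurable_EFinP := fi.
have mf' : measurable_fun (setT : set (borel G)) (fun t : borel G => Num.max (f t) 0).
  by apply: measurable_maxr => //; exact: measurable_cst.
have ff' : {ae m, forall t, f t = Num.max (f t) 0}.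
  by apply: ae_imp f0 => t ft; rewrite max_l.
exists (fun t => Num.max (f t) 0); split.
- apply: le_integrable fi => //; first exact/measurable_EFinP.
  move=> t _ /=; rewrite lee_fin ger0_norm ?max0_ge0// ge_max normr_ge0 andbT.
  exact: ler_norm.
- by move=> t; exact: max0_ge0.
- by rewrite -f1; apply/esym/ae_eq_Rintegral.
- apply/funext => x; apply: ae_eq_Rintegral => //.
  + by apply: measurable_funM => //; exact: (bounded_reflect hG hm x gM).1.
  + by apply: measurable_funM => //; exact: (bounded_reflect hG hm x gM).1.
  + by apply: ae_imp ff' => t <-.
Qed.

(** Inside a set of finite measure on which [f] is bounded and which carries most
    of its mass, a compact set of nearly full measure still carries most of the
    mass. *)
Lemma compact_concentration (f : G -> R) (e : R) :
  integrable f -> (forall t, 0 <= f t) -> 0 < e ->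
  exists B : set G, compact B /\ \int[m]_(t in ~` B) f t <= e.
Proof.
move=> fi f0 e0; have e20 : 0 < e / 2 by rewrite divr_gt0.
have [D [N [mD Dfin N0 H]]] := integrable_finite_support fi f0 e20.
have e3 : 0 < e / 2 / N by rewrite divr_gt0.
have [B [cB BD mB]] := inner_approx hG hm mD Dfin e3.
have mBb := compact_borel hG cB.
exists B; split => //; apply: (le_trans (H B mBb BD)).
rewrite [leRHS]splitr lerD2l mulrC -ler_pdivlMr//.
have Bf : m (D `\` B) \is a fin_num by rewrite ge0_fin_numE// (lt_trans mB)// ltry.
by rewrite -lee_fin fineK//; exact: ltW.
Qed.

Variables (disp : Order.disp_t) (Delta : preorderType disp).
Variable K : Delta -> set G.
Hypothesis hK : summing_net m K.
Variable s : Delta -> G.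
Variable U : set_system Delta.
Hypothesis UU : UltraFilter U.
Hypothesis Utail : forall d0 : Delta, U [set d | (d0 <= d)%O].

Let cK d : compact (K d). Proof. exact: (net_compact hK). Qed.
Let mK d : measurable (K d : set (borel G)). Proof. exact: compact_borel. Qed.
Let Kfin d : (m (K d) < +oo)%E. Proof. exact: haar_compact. Qed.
Let K0 d : (0 < m (K d))%E. Proof. exact: (net_gt0 hK). Qed.

(** An ultrafilter on a compact interval converges. *)
Lemma ultra_bounded_cvg (h : Delta -> R) (M : R) :
  (forall d, `|h d| <= M) -> h @ U --> lim (h @ U).
Proof.
move=> hM.
have cpt : forall F : set_system R, UltraFilter F -> F `[- M, M]%classic ->
    `[- M, M]%classic `&` [set p | F --> p] !=set0.
  by have := @segment_compact R (- M) M; rewrite compact_ultra.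
have [] := cpt (h @ U) (fmap_ultra h UU).
  by apply: (@filterE _ U _ (h @^-1` _)) => d; rewrite /= in_itv/= -ler_norml; exact: hM.
by move=> p [_ hp]; apply/cvg_ex; exists p.
Qed.

Definition ultra_avg (g : G -> R) : R := lim ((fun d => avg m (K d) g (s d)) @ U).

Lemma ultra_avg_cvg (g : G -> R) (M : R) : bounded_by g M ->
  (fun d => avg m (K d) g (s d)) @ U --> ultra_avg g.
Proof. by move=> gM; apply: (@ultra_bounded_cvg _ M) => d; exact: avg_le. Qed.

Lemma ultra_avgD (g h : G -> R) (M N : R) : bounded_by g M -> bounded_by h N ->
  ultra_avg (fun x => g x + h x) = ultra_avg g + ultra_avg h.
Proof.
move=> gM hN; apply: cvg_lim => //.
under eq_fun do rewrite (avgD (mK _) (Kfin _) _ gM hN).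
exact: cvgD (ultra_avg_cvg gM) (ultra_avg_cvg hN).
Qed.

Lemma ultra_avgZ (c : R) (g : G -> R) (M : R) : bounded_by g M ->
  ultra_avg (fun x => c * g x) = c * ultra_avg g.
Proof.
move=> gM; apply: cvg_lim => //.
under eq_fun do rewrite (avgZ (mK _) (Kfin _) _ _ gM).
apply: cvgM; [exact: cvg_cst|exact: ultra_avg_cvg gM].
Qed.

Lemma ultra_avg_cst (c : R) : ultra_avg (fun=> c) = c.
Proof.
apply: cvg_lim => //.
under eq_fun do rewrite (avg_cst (mK _) (Kfin _) (K0 _)).
exact: cvg_cst.
Qed.

Lemma ultra_avg_ge0 (g : G -> R) (M : R) : bounded_by g M ->
  {ae m, forall x, 0 <= g x} -> 0 <= ultra_avg g.
Proof.
move=> gM g0; apply: limr_ge; first by apply/cvg_ex; eexists; exact: ultra_avg_cvg gM.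
by apply: nearW => d; exact: avg_ge0 gM g0.
Qed.

Lemma ultra_avg_le (g : G -> R) (M : R) : bounded_by g M -> `|ultra_avg g| <= M.
Proof.
move=> gM; have c : cvg ((fun d => avg m (K d) g (s d)) @ U).
  by apply/cvg_ex; eexists; exact: ultra_avg_cvg gM.
rewrite ler_norml; apply/andP; split.
- apply: limr_ge => //; apply: nearW => d.
  by have := avg_le (mK d) (Kfin d) (K0 d) (s d) gM; rewrite ler_norml => /andP[].
- apply: limr_le => //; apply: nearW => d.
  by have := avg_le (mK d) (Kfin d) (K0 d) (s d) gM; rewrite ler_norml => /andP[].
Qed.

(** Apply [avg_rconv_le] with a compact set [B] which carries most of the mass of
    [f].  The Foelner condition on the compact set [- B] bounds [eta] for all
    large [d]. *)
Lemma ultra_avg_rconv (f g : G -> R) (M : R) : L1_prob m f -> bounded_by g M ->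
  ultra_avg (rconv m f g) = ultra_avg g.
Proof.
move=> fP gM; have M0 := ess_bounded_ge0 (haar_gt0 hm) gM.
have [f' [f'i f'0 f'1 ->]] := rconv_nonneg fP gM.
apply: cvg_lim => //.
have cg := ultra_avg_cvg gM.
suff cd : (fun d => avg m (K d) (rconv m f' g) (s d) - avg m (K d) g (s d)) @ U --> (0 : R).
  rewrite -[ultra_avg g]add0r.
  rewrite (_ : (fun d => avg m (K d) (rconv m f' g) (s d)) = (fun d =>
    (avg m (K d) (rconv m f' g) (s d) - avg m (K d) g (s d)) + avg m (K d) g (s d))).
    exact: cvgD cd cg.
  by apply/funext => d; rewrite subrK.
apply/cvgrPdist_le => e e0.
(* The final bound is [M * e1 + 2 * M * e1], at most [e]. *)
pose e1 := e / (3 * (M + 1)).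
have e10 : 0 < e1 by rewrite divr_gt0// mulr_gt0// ltr_wpDl.
have [B [cB fB]] := compact_concentration f'i f'0 e10.
have mB := compact_borel hG cB.
have [d0 Hd0] := net_foelner hK (compact_neg cB) e10.
apply: filterS (Utail d0) => d dd0 /=; rewrite sub0r normrN.
have k0 := fine_measure_gt0 (Kfin d) (K0 d).
have H t : B t -> fine (m (K d `+` translate (- t) (K d))) <= e1 * fine (m (K d)).
  move=> Bt; have := Hd0 d dd0 (- t); rewrite /= opprK => /(_ Bt).
  rewrite subr0 ger0_norm; last by apply: divr_ge0; exact: fine_ge0.
  by rewrite ltr_pdivrMr// => /ltW.
apply: (le_trans (avg_rconv_le hG hm (mK d) (Kfin d) (K0 d) (s d) f'i f'0 f'1 gM M0 mB (ltW e10) H)).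
apply: (@le_trans _ _ (3 * M * e1)).
  rewrite (_ : 3 * M * e1 = M * e1 + 2 * M * e1); last by lra.
  by rewrite lerD2l ler_wpM2l// mulr_ge0.
rewrite /e1 mulrA ler_pdivrMr ?mulr_gt0// ?ltr_wpDl//.
nra.
Qed.

End UltraMean.

(** * Characterization of almost convergence *)

Section Forward.
Variables (R : realType) (G : topologicalZmodType).
Hypothesis hG : hausdorff_space G.
Variable m : {measure set (borel G) -> \bar R}.
Hypothesis hm : haar_measure m.
Variables (disp : Order.disp_t) (Delta : preorderType disp).
Variable K : Delta -> set G.
Hypothesis hK : summing_net m K.
Local Notation Re := complex.Re.
Local Notation Im := complex.Im.
Local Open Scope complex_scope.

Definition ultra_mean (s : Delta -> G) (U : set_system Delta) (psi : G -> R[i]) : R[i] :=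
  (ultra_avg m K s U (fun x => Re (psi x))) +i* (ultra_avg m K s U (fun x => Im (psi x))).

Lemma ultra_mean_TIM (s : Delta -> G) (U : set_system Delta) :
  UltraFilter U -> (forall d0 : Delta, U [set d | (d0 <= d)%O]) ->
  TIM m (ultra_mean s U).
Proof.
move=> UU Utail; split; first split; first split.
- move=> a psi1 psi2 L1 L2.
  have r1 := Linfty_bounded_Re hm L1; have i1 := Linfty_bounded_Im hm L1.
  have r2 := Linfty_bounded_Re hm L2; have i2 := Linfty_bounded_Im hm L2.
  rewrite /ultra_mean; case: a => a b.
  have -> : (fun x => Re ((a +i* b) * psi1 x + psi2 x)) =
      (fun x => (a * Re (psi1 x) + (- b) * Im (psi1 x)) + Re (psi2 x)).
    by apply/funext => x; case: (psi1 x) => ? ?; case: (psi2 x) => ? ? /=; rewrite mulNr.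
  have -> : (fun x => Im ((a +i* b) * psi1 x + psi2 x)) =
      (fun x => (a * Im (psi1 x) + b * Re (psi1 x)) + Im (psi2 x)).
    by apply/funext => x; case: (psi1 x) => ? ?; case: (psi2 x) => ? ? /=.
  have D := ultra_avgD hG hm hK s UU; have Z := ultra_avgZ hG hm hK s UU.
  rewrite (D _ _ _ _ (ess_boundedD (ess_boundedZ a r1) (ess_boundedZ (- b) i1)) r2).
  rewrite (D _ _ _ _ (ess_boundedZ a r1) (ess_boundedZ (- b) i1)).
  rewrite (D _ _ _ _ (ess_boundedD (ess_boundedZ a i1) (ess_boundedZ b r1)) i2).
  rewrite (D _ _ _ _ (ess_boundedZ a i1) (ess_boundedZ b r1)).
  rewrite (Z a _ _ r1) (Z (- b) _ _ i1) (Z a _ _ i1) (Z b _ _ r1).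
  by rewrite mulNr.
- exists 2 => psi L; rewrite (Linfty_norm_fin L) -EFinM lee_fin.
  apply: (le_trans (cmod_le _)); rewrite mulr_natl mulr2n; apply: lerD.
  + exact: (ultra_avg_le hG hm hK s UU (Linfty_bounded_Re hm L)).
  + exact: (ultra_avg_le hG hm hK s UU (Linfty_bounded_Im hm L)).
- move=> psi L psi0; rewrite lecE /=; apply/andP; split.
    (* The imaginary part vanishes almost everywhere, so positivity
       applies to it and to its opposite. *)
    have i0 : {ae m, forall x, 0 <= (-1) * Im (psi x)}.
      by apply: ae_imp psi0 => x; rewrite lecE /= => /andP[/eqP -> _]; rewrite mulr0.
    have i1 : {ae m, forall x, 0 <= Im (psi x)}.
      by apply: ae_imp psi0 => x; rewrite lecE /= => /andP[/eqP -> _].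
    have iM := Linfty_bounded_Im hm L.
    rewrite eq_le (ultra_avg_ge0 hG hm hK s UU iM i1) andbT.
    have := ultra_avg_ge0 hG hm hK s UU (ess_boundedZ (-1) iM) i0.
    by rewrite (ultra_avgZ hG hm hK s UU (-1) iM) mulN1r oppr_ge0.
  apply: (ultra_avg_ge0 hG hm hK s UU (Linfty_bounded_Re hm L)).
  by apply: ae_imp psi0 => x; rewrite lecE => /andP[].
- by rewrite /ultra_mean /= !(ultra_avg_cst hG hm hK s UU).
- move=> psi f L fP; rewrite /ultra_mean.
  have -> : (fun x => Re (convolution m f psi x)) = rconv m f (fun x => Re (psi x)).
    by apply/funext => x; rewrite convolutionE.
  have -> : (fun x => Im (convolution m f psi x)) = rconv m f (fun x => Im (psi x)).
    by apply/funext => x; rewrite convolutionE.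
  congr (_ +i* _).
  + exact: (ultra_avg_rconv hG hm hK s UU Utail fP (Linfty_bounded_Re hm L)).
  + exact: (ultra_avg_rconv hG hm hK s UU Utail fP (Linfty_bounded_Im hm L)).
Qed.

(** A failure of uniformity selects points [s d] for a cofinal set of indices [d].
    An ultrafilter concentrated on these indices yields an invariant mean whose
    value at [psi] differs from [alpha]. *)
Lemma almost_convergent_uniform (psi : G -> R[i]) (hpsi : Linfty m psi) (alpha : R[i]) :
  almost_convergent m psi alpha ->
  net_cvg_unif [set: G] (fun d s => net_average m (K d) psi s) alpha.
Proof.
move=> H e e0; apply: contrapT => nH.
have e0R : 0 < Re e by move: e0; rewrite ltcE => /andP[].
have eE : e = (Re e)%:C.
  by move: e0; case: (e) => a b; rewrite ltcE /= => /andP[/eqP -> _].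
have [s Hs] : exists s : Delta -> G, forall d,
    (exists u, ~ (`|net_average m (K d) psi u - alpha| < e)) ->
    ~ (`|net_average m (K d) psi (s d) - alpha| < e).
  have /choice [s Hs] : forall d, exists u : G,
    (exists u, ~ (`|net_average m (K d) psi u - alpha| < e)) ->
    ~ (`|net_average m (K d) psi u - alpha| < e).
    move=> d; have [[u Hu]|nu] := pselect (exists u, ~ (`|net_average m (K d) psi u - alpha| < e)).
      by exists u.
    by exists 0.
  by exists s.
pose bad d := ~ (`|net_average m (K d) psi (s d) - alpha| < e).
have Hbad d0 : exists d, (d0 <= d)%O /\ bad d.
  apply: contrapT => nd; apply: nH; exists d0 => d dd0 u _.
  apply: contrapT => nu; apply: nd; exists d; split => //.
  by apply: Hs; exists u.
have [[d00 _] dir] := net_directed hK.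
pose F : set_system Delta := [set A | exists d0, forall d, (d0 <= d)%O -> bad d -> A d].
have PF : ProperFilter F.
  split; last split.
  - by move=> [d0 Hd0]; have [d [dd0 bd]] := Hbad d0; exact: Hd0 dd0 bd.
  - by exists d00.
  - move=> A B [a Ha] [b Hb]; have [c [ac bc]] := dir a b.
    exists c => d cd bd; split; [apply: Ha|apply: Hb] => //.
    + exact: le_trans ac cd.
    + exact: le_trans bc cd.
  - by move=> A B AB [a Ha]; exists a => d ad bd; exact: AB (Ha _ ad bd).
have [U [UU FU]] := ultraFilterLemma PF.
have Utail d0 : U [set d | (d0 <= d)%O] by apply: FU; exists d0.
have Ubad : U bad by apply: FU; exists d00.
have phiE := H _ (ultra_mean_TIM s UU Utail).
have cr := ultra_avg_cvg hG hm hK UU (Linfty_bounded_Re hm hpsi).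
have ci := ultra_avg_cvg hG hm hK UU (Linfty_bounded_Im hm hpsi).
have {}cr := cr s; have {}ci := ci s.
rewrite (congr1 (@complex.Re R) phiE : ultra_avg m K s U _ = Re alpha) in cr.
rewrite (congr1 (@complex.Im R) phiE : ultra_avg m K s U _ = Im alpha) in ci.
have e20 : 0 < Re e / 2 by rewrite divr_gt0.
move/cvgrPdist_lt : cr => /(_ _ e20) cr; move/cvgrPdist_lt : ci => /(_ _ e20) ci.
have [d [[hr hi] bd]] := filter_ex (filterI (filterI cr ci) Ubad).
apply: bd; rewrite eE norm_complexE ltcR net_averageE.
apply: le_lt_trans (cmod_le _) _; rewrite !raddfB /= [ltRHS]splitr.
by apply: ltrD; rewrite distrC.
Qed.

End Forward.

Theorem theorem2p4 (R : realType) (G : topologicalZmodType)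
    (hG : lca_group G)
    (m : {measure set (borel G) -> \bar R}) (hm : haar_measure m)
    (disp : Order.disp_t) (Delta : preorderType disp)
    (K : Delta -> set G) (hK : summing_net m K)
    (psi : G -> R[i]) (hpsi : Linfty m psi) (alpha : R[i]) :
  almost_convergent m psi alpha <->
  net_cvg_unif [set: G] (fun d s => net_average m (K d) psi s) alpha.
Proof.
have [hH _] := hG; split.
- exact: almost_convergent_uniform.
- exact: uniform_almost_convergent.
Qed.
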